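(* Let $M$ be a $3$-connected simple binary matroid having an element $e$ such that neither $M$ nor $M\backslash e$ has $M(K_4)$ as an induced minor. Then every element of $E(M)-\{e\}$ is in a triangle (3-element circuit) of $M$ with $e$.
   Context: All matroids are simple; every contraction is immediately followed by simplification. An induced minor of $M$ is a matroid obtained from $M$ by a sequence of restrictions to flats and contractions (each contraction followed by simplification). *)

(* Defs.v *)
From HB Require Import structures.
From mathcomp Require Import all_boot all_order all_algebra.

Set Implicit Arguments.
Unset Strict Implicit.
Unset Printing Implicit Defensive.

(** Finite matroids whose elements are drawn from a finType [T].  The ground
    set is an arbitrary subset of [T], so a matroid and all of its minors have
    the same type. *)

Record matroid (T : finType) := Matroid {
  ground : {set T};
  indep : {set {set T}};
  indep_ground : forall I, I \in indep -> I \subset ground;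
  indep_set0 : set0 \in indep;
  indep_subset : forall I J : {set T},
    J \subset I -> I \in indep -> J \in indep;
  indep_augment : forall I J : {set T},
    I \in indep -> J \in indep -> #|I| < #|J| ->
    exists2 x, x \in J :\: I & x |: I \in indep }.

Section Notions.

Variable T : finType.
Implicit Types (M N : matroid T) (A C F S X : {set T}) (x y : T).

Definition rank M A : nat :=
  \max_(I in indep M | I \subset A) #|I|.

Definition circuit M C : bool :=
  minset [pred A : {set T} | (A \subset ground M) && (A \notin indep M)] C.

Definition triangle M C : bool := circuit M C && (#|C| == 3).

Definition simple_matroid M : Prop := forall C, circuit M C -> 2 < #|C|.

Definition cl M A : {set T} :=
  [set x in ground M | rank M (x |: A) == rank M A].

Definition flat M F : bool := cl M F == F.

(* [k <= #|X|], [k <= #|E - X|] and [r(X) + r(E - X) - r(M) <= k - 1],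
   the last one being rearranged to avoid truncated subtraction. *)
Definition separation M (k : nat) X : bool :=
  [&& X \subset ground M, k <= #|X|, k <= #|ground M :\: X|
    & rank M X + rank M (ground M :\: X) < rank M (ground M) + k].

Definition n_connected (n : nat) M : Prop :=
  forall (k : nat) X, 0 < k < n -> ~~ separation M k X.

Definition representable (K : fieldType) M : Prop :=
  exists (n : nat) (v : T -> 'rV[K]_n),
    forall X, X \subset ground M ->
      (X \in indep M) = free [seq v x | x in X].

Definition binary M : Prop := representable 'F_2 M.

Section Restriction.

Variables (M : matroid T) (A : {set T}).

Definition restrict_indep : {set {set T}} :=
  [set I in indep M | I \subset A].

Fact restrict_ground (I : {set T}) : I \in restrict_indep -> I \subset ground M :&: A.
Proof. by rewrite inE subsetI => /andP[/indep_ground-> ->]. Qed.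

Fact restrict_set0 : set0 \in restrict_indep.
Proof. by rewrite inE indep_set0 sub0set. Qed.

Fact restrict_subset (I J : {set T}) :
  J \subset I -> I \in restrict_indep -> J \in restrict_indep.
Proof.
move=> sJI; rewrite !inE => /andP[iI sIA].
by rewrite (indep_subset sJI iI) (subset_trans sJI sIA).
Qed.

Fact restrict_augment (I J : {set T}) :
  I \in restrict_indep -> J \in restrict_indep -> #|I| < #|J| ->
  exists2 x, x \in J :\: I & x |: I \in restrict_indep.
Proof.
rewrite !inE => /andP[iI sIA] /andP[iJ sJA] ltIJ.
have [x xJI ixI] := indep_augment iI iJ ltIJ; exists x => //.
rewrite inE ixI subUset sub1set sIA andbT /=.
by move: xJI; rewrite inE => /andP[_ /(subsetP sJA)].
Qed.

Definition restrict : matroid T :=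
  Matroid restrict_ground restrict_set0 restrict_subset restrict_augment.

End Restriction.

Definition delete M x : matroid T := restrict M (ground M :\ x).

Section Contraction.

Variables (M : matroid T) (X : {set T}).

(* A basis of the restriction of [M] to [X]. *)
Definition basis : {set T} :=
  [arg max_(B > set0 | (B \in indep M) && (B \subset X)) #|B|].

Fact basis_indep : basis \in indep M.
Proof.
by rewrite /basis; case: arg_maxnP => [|B /andP[]//]; rewrite indep_set0 sub0set.
Qed.

Fact basis_subset : basis \subset X.
Proof.
by rewrite /basis; case: arg_maxnP => [|B /andP[]//]; rewrite indep_set0 sub0set.
Qed.

(* The independent sets of M/X are the I contained in E - X such that I :|: B
   is independent in M, where B is a basis of M|X; they do not depend on the
   choice of B (lemma contract_indepE). *)
Definition contract_indep : {set {set T}} :=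
  [set I : {set T} | (I \subset ground M :\: X) && (I :|: basis \in indep M)].

Fact contract_ground (I : {set T}) :
  I \in contract_indep -> I \subset ground M :\: X.
Proof. by rewrite inE => /andP[]. Qed.

Fact contract_set0 : set0 \in contract_indep.
Proof. by rewrite inE sub0set set0U basis_indep. Qed.

Fact contract_subset (I J : {set T}) :
  J \subset I -> I \in contract_indep -> J \in contract_indep.
Proof.
move=> sJI; rewrite !inE => /andP[sI iI].
by rewrite (subset_trans sJI sI) (indep_subset _ iI) // setSU.
Qed.

Fact contract_card (I : {set T}) : I \subset ground M :\: X ->
  #|I :|: basis| = #|I| + #|basis|.
Proof.
rewrite subsetD => /andP[_ dIX]; apply/eqP; rewrite (leq_card_setU I basis).
by apply: disjointWr basis_subset dIX.
Qed.

Fact contract_augment (I J : {set T}) :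
  I \in contract_indep -> J \in contract_indep -> #|I| < #|J| ->
  exists2 x, x \in J :\: I & x |: I \in contract_indep.
Proof.
rewrite !inE => /andP[sI iI] /andP[sJ iJ] ltIJ.
have [|x xJI ixI] := indep_augment iI iJ.
  by rewrite !contract_card // ltn_add2r.
move: xJI; rewrite !inE negb_or => /andP[/andP[xI xB] /orP[xJ|]]; last first.
  by rewrite (negPf xB).
exists x; first by rewrite inE xI.
by rewrite inE subUset sub1set (subsetP sJ) // sI -setUA.
Qed.

Definition contract : matroid T :=
  Matroid contract_ground contract_set0 contract_subset contract_augment.

End Contraction.

Lemma indep_rank M I A : I \in indep M -> I \subset A -> #|I| <= rank M A.
Proof.
by move=> iI sIA; rewrite /rank (bigD1 I) /= ?leq_maxl // iI.
Qed.

Lemma card_basis M X : #|basis M X| = rank M X.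
Proof.
have i0 : (set0 \in indep M) && (set0 \subset X) by rewrite indep_set0 sub0set.
by rewrite /rank (bigmax_eq_arg set0).
Qed.

Lemma indep_extend M (I J : {set T}) :
  I \in indep M -> J \in indep M -> #|I| <= #|J| ->
  exists I', [/\ I' \in indep M, I \subset I', I' \subset I :|: J
                 & #|I'| = #|J|].
Proof.
move=> iI iJ; have [n] := ubnP (#|J| - #|I|).
elim: n I iI => // n IHn I iI leJ; rewrite leq_eqVlt => /orP[/eqP eqIJ | ltIJ].
  by exists I; rewrite subsetUl.
have [x xJI ixI] := indep_augment iI iJ ltIJ.
move: xJI; rewrite inE => /andP[xI xJ].
have cxI : #|x |: I| = #|I|.+1 by rewrite cardsU1 xI.
have [||I' [iI' sxI sI' cI']] := IHn _ ixI; rewrite ?cxI //.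
  by rewrite -ltnS (leq_trans _ leJ) // ltnS subnS prednK // subn_gt0.
exists I'; split=> //; first by apply: subset_trans sxI; exact: subsetUr.
apply: (subset_trans sI'); rewrite -setUA subUset sub1set subxx andbT.
by rewrite inE xJ orbT.
Qed.

Lemma contract_indepE M X (I : {set T}) :
  (I \in indep (contract M X)) =
  (I \subset ground M :\: X) && (rank M (I :|: X) == #|I| + rank M X).
Proof.
rewrite inE; case: (boolP (I \subset _)) => //= sI.
have noX (B : {set T}) x : B \in indep M -> basis M X \subset B -> x \in X ->
    x \in B -> x \in basis M X.
  move=> iB sB xX xB; apply: contraT => xnb.
  have: #|x |: basis M X| <= rank M X.
    apply: indep_rank; last by rewrite subUset sub1set xX basis_subset.
    by apply: indep_subset iB; rewrite subUset sub1set xB.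
  by rewrite cardsU1 xnb card_basis ltnn.
have [iJ sJ cJ] := And3 (basis_indep M (I :|: X)) (basis_subset M (I :|: X))
  (card_basis M (I :|: X)); set J := basis M (I :|: X) in iJ sJ cJ.
have leXJ : #|basis M X| <= #|J|.
  rewrite cJ indep_rank ?basis_indep //.
  by rewrite (subset_trans (basis_subset M X)) ?subsetUr.
have [B [iB sbB sB cB]] := indep_extend (basis_indep M X) iJ leXJ.
have sBI : B \subset I :|: basis M X.
  apply/subsetP=> x xB; rewrite inE orbC.
  have /(subsetP sB) := xB; rewrite inE => /orP[-> //|/(subsetP sJ)].
  rewrite inE => /orP[->|xX]; first by rewrite orbT.
  by rewrite (noX B).
have cI := contract_card sI; rewrite card_basis in cI.
apply/idP/eqP => [iIb | eq_r].
  apply/eqP; rewrite eqn_leq -cI -{1}cJ -cB subset_leq_card //=.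
  by rewrite indep_rank // setUS ?basis_subset.
suff <- : B = I :|: basis M X by [].
by apply/eqP; rewrite eqEcard sBI cI cB cJ eq_r leqnn.
Qed.

Definition loop M x : bool := circuit M [set x].

Definition nonloops M : {set T} := [set x in ground M | ~~ loop M x].

Definition parallel M x y : bool := (x == y) || circuit M [set x; y].

(* [S] is the ground set of a simplification of [M]: all loops are deleted, and
   exactly one element is kept in each parallel class. *)
Definition simplification_set M S : Prop :=
  S \subset nonloops M /\
  forall x, x \in nonloops M -> exists! y, y \in S /\ parallel M x y.

(* Simplifications are determined only up to isomorphism; every choice of
   representatives of the parallel classes is allowed. *)
Inductive induced_minor M : matroid T -> Prop :=
| induced_minor_refl : induced_minor M M
| induced_minor_flat N F :
    induced_minor M N -> flat N F -> induced_minor M (restrict N F)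
| induced_minor_contract N X S :
    induced_minor M N -> X \subset ground N ->
    simplification_set (contract N X) S ->
    induced_minor M (restrict (contract N X) S).

End Notions.

(* A simple graph on the vertex type [V] is given by its set [E] of edges, which
   are 2-element subsets of [V]. *)
Section Graphic.

Variable V : finType.

Definition adjacent (E : {set {set V}}) : rel V :=
  [rel u v | (u != v) && ([set u; v] \in E)].

Definition forest (E : {set {set V}}) : Prop :=
  forall c : seq V, 2 < size c -> ~ ucycle (adjacent E) c.

Definition complete_graph : {set {set V}} := [set A : {set V} | #|A| == 2].

(* [M] is isomorphic to the cycle matroid M(G) of G = (V, E), whose ground set
   is E and whose independent sets are the edge sets of forests. *)
Definition iso_cycle_matroid (E : {set {set V}}) (T : finType)
    (M : matroid T) : Prop :=
  exists f : T -> {set V},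
    [/\ {in ground M &, injective f}, f @: ground M = E
      & forall X : {set T}, X \subset ground M ->
          (X \in indep M) <-> forest (f @: X)].

End Graphic.

Definition has_induced_minor_MK4 (T : finType) (M : matroid T) : Prop :=
  exists N : matroid T,
    induced_minor M N /\ iso_cycle_matroid (complete_graph 'I_4) N.

(* Main.v *)
(** Represent [M] by a set [E] of nonzero vectors over F_2.  A point [x] is on a
    triangle with [e] iff [x + e] is in [E]; let [C] be the set of points for
    which this fails, and suppose that [E] is a counterexample of minimum rank,
    with [c] in [C].  As [c + e] is not in [E], contracting [c] preserves the
    hypotheses on M(K_4), both for [E] and for [E - e].

    The contraction [E / c] need not be 3-connected, but all its 2-separations
    are at [e].  Indeed, a 2-separation at another point [t] comes from a
    3-separation [(X, Y)] of [E], with [e] in [X], along the line through [c]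
    and [t]; contracting a subset of [Y] so that the rest of [Y] covers this
    line gives a smaller counterexample.  By induction, applied to the parts of
    [E / c] that are glued at [e], every point of [E / c] is on a triangle with
    [e]: for all [c] in [C] and [y] in [E] other than [c] and [e], one of
    [y + e] and [y + e + c] is in [E].

    This forces [c1 + c2 + c3 = e] for distinct [c1], [c2], [c3] in [C], since
    otherwise contracting [c3] produces a plane of [E - e] in which only [e] is
    missing.  Hence [C] has at most three points.  Excluding M(K_4) in [E] also
    shows that no point of [C] is in the span of [E - C], so that either a
    point of [C] is a coloop or [(C, E - C)] is a 2-separation, unless [E] is a
    circuit with four elements; each contradicts 3-connectedness. *)

Require Import Defs.
From mathcomp Require Import all_boot all_order all_algebra.

Set Implicit Arguments.
Unset Strict Implicit.
Unset Printing Implicit Defensive.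

Import GRing.Theory.
Local Open Scope ring_scope.

(** * Arithmetic over the two-element field *)

Lemma F2_cases (z : 'F_2) : z = 0 \/ z = 1.
Proof.
by case: z => [[|[|k]] // Hk]; [left | right]; apply: val_inj.
Qed.

(** Vector identities in characteristic 2 are decided entrywise: every entry is 0 or 1, and each
    case is closed by evaluation. *)
Ltac vec_ring :=
  let i := fresh "i" in
  apply/rowP => i; rewrite !mxE;
  repeat match goal with
  | |- context [fun_of_matrix ?a ?j ?k] =>
      let z := fresh "z" in
      set z := (fun_of_matrix a j k); clearbody z; case: (F2_cases z) => ->
  end;
  by apply: val_inj.

Lemma disjointsU1 (T : finType) (x : T) (A B : {set T}) :
  [disjoint x |: A & B] = (x \notin B) && [disjoint A & B].
Proof. by rewrite !disjoints_subset subUset sub1set inE. Qed.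

(** * Spans over F_2 *)

Section Span.

Variable n : nat.
Notation V := 'rV['F_2]_n.
Implicit Types (A B C E S X Y : {set V}) (U W : {vspace V}) (u v w x y : V).

Definition sp A : {vspace V} := <<enum A>>%VS.

Lemma F2_addvv v : v + v = 0.
Proof. by vec_ring. Qed.

Lemma F2_oppv v : - v = v.
Proof. by vec_ring. Qed.

Lemma F2_addvK v w : v + w + w = v.
Proof. by rewrite -addrA F2_addvv addr0. Qed.

Lemma F2_addv_eq0 v w : (v + w == 0) = (v == w).
Proof. by rewrite -{1}(F2_oppv w) subr_eq0. Qed.

Lemma memv_addr U v w : v \in U -> (v + w \in U) = (w \in U).
Proof. by move=> vU; rewrite rpredDl. Qed.

Lemma memv_addl U v w : v \in U -> (w + v \in U) = (w \in U).
Proof. by move=> vU; rewrite rpredDr. Qed.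

(** In characteristic 2, [u + v \in U] means that [u] and [v] are congruent modulo [U]. This is
    transitivity; by [memv_hit], membership in [U] depends only on the class. *)
Lemma memv_hit_trans U u v w : u + v \in U -> v + w \in U -> u + w \in U.
Proof.
move=> uv vw; have -> : u + w = (u + v) + (v + w) by vec_ring.
exact: rpredD.
Qed.

Lemma memv_hit U v w : v + w \in U -> (v \in U) = (w \in U).
Proof.
move=> vw; apply/idP/idP => h.
  by rewrite -(memv_addr _ h).
by rewrite -(memv_addl _ h).
Qed.

Lemma mem_sp A v : v \in A -> v \in sp A.
Proof. by move=> vA; apply: memv_span; rewrite mem_enum. Qed.

Lemma sp_sub A U : (forall v, v \in A -> v \in U) -> (sp A <= U)%VS.
Proof. by move=> AU; apply/span_subvP => v; rewrite mem_enum; apply: AU. Qed.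

Lemma spS A B : A \subset B -> (sp A <= sp B)%VS.
Proof. by move=> /subsetP AB; apply: sp_sub => v /AB/mem_sp. Qed.

Lemma mem_spS A B v : A \subset B -> v \in sp A -> v \in sp B.
Proof. by move=> /spS/subvP; apply. Qed.

Lemma spU A B : sp (A :|: B) = (sp A + sp B)%VS.
Proof.
apply/eqP; rewrite eqEsubv; apply/andP; split.
  apply: sp_sub => v; rewrite inE => /orP[] /mem_sp vA.
    by rewrite (subvP (addvSl _ _)).
  by rewrite (subvP (addvSr _ _)).
by rewrite subv_add !spS ?subsetUl ?subsetUr.
Qed.

Lemma spUP A B w :
  w \in sp (A :|: B) ->
  exists u v, [/\ u \in sp A, v \in sp B & w = u + v].
Proof. by rewrite spU => /memv_addP[u uA [v vB ->]]; exists u, v. Qed.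

Lemma memv_line2 x w : w \in <[x]>%VS -> w = 0 \/ w = x.
Proof.
by case/vlineP => k ->; case: (F2_cases k) => ->; [left|right];
  rewrite ?scale0r ?scale1r.
Qed.

Lemma sp1 x : sp [set x] = <[x]>%VS.
Proof. by rewrite /sp enum_set1 span_seq1. Qed.

Lemma sp0 : sp set0 = 0%VS.
Proof. by rewrite /sp enum_set0 span_nil. Qed.

Lemma memv_sp0 w : (w \in sp set0) = (w == 0).
Proof. by rewrite sp0 memv0. Qed.

Lemma memv_addline U x w :
  w \in (U + <[x]>)%VS -> w \in U \/ w + x \in U.
Proof.
case/memv_addP => u uU [v /memv_line2[] -> ->]; first by left; rewrite addr0.
by right; rewrite F2_addvK.
Qed.

Lemma spU1P A x w : w \in sp (x |: A) -> w \in sp A \/ w + x \in sp A.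
Proof. by rewrite spU sp1 addvC => /memv_addline. Qed.

Lemma spUl A B w : w \in sp A -> w \in sp (A :|: B).
Proof. exact/mem_spS/subsetUl. Qed.

Lemma spUr A B w : w \in sp B -> w \in sp (A :|: B).
Proof. exact/mem_spS/subsetUr. Qed.

Lemma sum_sp A B : B \subset A -> \sum_(q in B) q \in sp A.
Proof. by move=> /subsetP BA; apply: rpred_sum => q /BA/mem_sp. Qed.

(* If [b] already occurs in the sum, then the two copies cancel. *)
Lemma sum_add_elem b A :
  exists A' : {set V}, [/\ A' \subset b |: A, (#|A'| <= #|A|.+1)%N &
    \sum_(q in A') q = b + \sum_(q in A) q].
Proof.
case: (boolP (b \in A)) => bA.
  exists (A :\ b); split; first by rewrite subsetU // subD1set orbT.
    by rewrite (leq_trans (subset_leq_card (subD1set _ _))).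
  by rewrite [in RHS](big_setD1 b) //= addrA F2_addvv add0r.
by exists (b |: A); rewrite cardsU1 bA big_setU1.
Qed.

Lemma spP A w : w \in sp A -> exists2 Q : {set V}, Q \subset A & w = \sum_(q in Q) q.
Proof.
have [m] := ubnP #|A|; elim: m => // m IH in A w *.
case: (set_0Vmem A) => [-> _|[x xA]].
  by rewrite memv_sp0 => /eqP->; exists set0; rewrite ?sub0set ?big_set0.
rewrite (cardsD1 x) xA => ltm; rewrite -(setD1K xA) => /spU1P[] wA.
  have [Q QA ->] := IH _ _ ltm wA.
  by exists Q => //; rewrite subsetU // QA orbT.
have [Q QA eqw] := IH _ _ ltm wA.
exists (x |: Q); first by rewrite setUS.
rewrite big_setU1 /=; last first.
  by apply/negP => xQ; have:= subsetP QA _ xQ; rewrite !inE eqxx.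
by rewrite -eqw addrC F2_addvK.
Qed.

Lemma dim_sp A : (\dim (sp A) <= #|A|)%N.
Proof. by rewrite cardE; apply: dim_span. Qed.

(** A complement of [U + <[c]>] is added to [U]. The resulting hyperplane contains exactly one
    element of each class [{v, v + c}]. *)
Lemma memv_hyperplane U c :
  c \notin U -> exists W, [/\ (U <= W)%VS, c \notin W &
    forall v, v \in W \/ v + c \in W].
Proof.
move=> cU; pose W := (U + (U + <[c]>)^C)%VS.
have full v : v \in (W + <[c]>)%VS.
  have -> : (W + <[c]>)%VS = (U + <[c]> + (U + <[c]>)^C)%VS.
    by rewrite /W -!addvA [((U + <[c]>)^C + _)%VS]addvC.
  by rewrite addv_complf memvf.
exists W; split; [exact: addvSl| |by move=> v; apply: memv_addline].
apply/negP => /memv_addP[u uU [v vC eqc]].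
have : v \in ((U + <[c]>) :&: (U + <[c]>)^C)%VS.
  rewrite memv_cap vC andbT.
  have -> : v = u + c by rewrite eqc; vec_ring.
  by rewrite memv_add ?memv_line.
by rewrite capv_compl memv0 => /eqP v0; move: cU; rewrite eqc v0 addr0 uU.
Qed.

End Span.

(** * Excluding M(K_4) *)

Section K4.

Variable n : nat.
Notation V := 'rV['F_2]_n.
Implicit Types (A B C E F S X Y Z : {set V}) (U W : {vspace V}).
Implicit Types (a b c e g t u v w x y : V).

(** Contraction without quotient spaces: the class of [v] modulo [U] contains a point of [E]. *)
Definition hit E U v : bool := [exists w, (w \in E) && (w + v \in U)].

Lemma hitP E U v : reflect (exists2 w, w \in E & w + v \in U) (hit E U v).
Proof.
by apply: (iffP existsP) => [[w /andP[]]|[w]]; exists w => //; apply/andP.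
Qed.

Lemma mem_hit E U v : v \in E -> hit E U v.
Proof. by move=> vE; apply/hitP; exists v; rewrite // F2_addvv mem0v. Qed.

(** Linear independence of [a], [b], [c] modulo [U]: over F_2 it says that the seven nonempty sums
    are outside [U]. *)
Definition indep3 U a b c : bool :=
  [&& a \notin U, b \notin U, c \notin U, a + b \notin U, a + c \notin U,
      b + c \notin U & a + b + c \notin U].

(* For a set of points [E], having no induced minor M(K_4) means that no
   rank-3 interval [sp X < W] of spans meets exactly six of the seven nonzero
   classes of [W] modulo [sp X]; in the basis [a, b, c] chosen here the
   potentially missing class is that of [a + b + c]. *)
Definition K4_closed E : Prop :=
  forall X a b c, X \subset E -> a \in E -> b \in E -> c \in E ->
  indep3 (sp X) a b c -> hit E (sp X) (a + b) -> hit E (sp X) (a + c) ->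
  hit E (sp X) (b + c) -> hit E (sp X) (a + b + c).

(** The hypotheses make [F] the restriction of the contraction of [E] by [Z] to a flat. An interval
    over [sp X] in [F] lifts to one over [sp X'] in [E], where [X'] is [Z] with the points of [E] in
    [sp X + sp Z]; as [sp F] meets [sp Z] only in 0, distinct classes stay distinct. *)
Lemma K4_closed_minor E F Z :
  Z \subset E -> (forall v, v \in F -> hit E (sp Z) v) ->
  (forall w, w \in E -> w \in (sp F + sp Z)%VS ->
     w \in sp Z \/ hit F (sp Z) w) ->
  (forall v, v \in sp F -> v \in sp Z -> v = 0) ->
  K4_closed E -> K4_closed F.
Proof.
move=> ZE EF FE FZ clE X a b c XF aF bF cF.
have spXF u : u \in sp X -> u \in sp F by apply: mem_spS.
pose X' := Z :|: [set w in E | w \in (sp X + sp Z)%VS].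
have X'E : X' \subset E.
  by apply/subsetP => w; rewrite !inE => /orP[/(subsetP ZE)|/andP[]].
have ZX' u : u \in sp Z -> u \in sp X' by apply: spUl.
have X'P u : u \in sp X' -> u \in (sp X + sp Z)%VS.
  apply: (subvP (sp_sub _)) => {u}u; rewrite !inE => /orP[/mem_sp uZ|/andP[]//].
  by apply: (subvP (addvSr _ _)).
have spX' u : u \in sp X -> u \in sp X'.
  apply: (subvP (sp_sub _)) => {u}u uX.
  have [w wE wu] := hitP _ _ _ (EF u (subsetP XF u uX)).
  rewrite -(memv_hit (ZX' _ wu)) mem_sp // !inE wE /=; apply/orP; right.
  have -> : w = u + (w + u) by vec_ring.
  by rewrite memv_add // mem_sp.
have XP u : u \in sp F -> u \in sp X' -> u \in sp X.
  move=> uF /X'P/memv_addP[x xX [z zZ eqz]].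
  have z0 : z = 0.
    apply: FZ => //; have -> : z = x + u by rewrite eqz; vec_ring.
    by rewrite rpredD // spXF.
  by rewrite eqz z0 addr0.
have [a' a'E aa'] := hitP _ _ _ (EF a aF).
have [b' b'E bb'] := hitP _ _ _ (EF b bF).
have [c' c'E cc'] := hitP _ _ _ (EF c cF).
have [aS bS cS] := And3 (mem_sp aF) (mem_sp bF) (mem_sp cF).
have ab : a' + b' + (a + b) \in sp Z.
  have -> : a' + b' + (a + b) = (a' + a) + (b' + b) by vec_ring.
  exact: rpredD.
have ac : a' + c' + (a + c) \in sp Z.
  have -> : a' + c' + (a + c) = (a' + a) + (c' + c) by vec_ring.
  exact: rpredD.
have bc : b' + c' + (b + c) \in sp Z.
  have -> : b' + c' + (b + c) = (b' + b) + (c' + c) by vec_ring.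
  exact: rpredD.
have abc : a' + b' + c' + (a + b + c) \in sp Z.
  have -> : a' + b' + c' + (a + b + c) = (a' + b' + (a + b)) + (c' + c).
    by vec_ring.
  exact: rpredD.
have lift u u' : u' + u \in sp Z -> u \in sp F -> u \notin sp X ->
    u' \notin sp X'.
  by move=> uu' uF; apply: contra; rewrite (memv_hit (ZX' _ uu')); apply: XP.
have hlift u u' : u' + u \in sp Z -> hit F (sp X) u -> hit E (sp X') u'.
  move=> uu' /hitP[w wF wu]; have [w' w'E ww'] := hitP _ _ _ (EF w wF).
  apply/hitP; exists w' => //.
  apply: memv_hit_trans (ZX' _ ww') _; apply: memv_hit_trans (spX' _ wu) _.
  by rewrite addrC ZX'.
case/and5P=> a0 b0 c0 ab0 /and3P[ac0 bc0 abc0] hab hac hbc.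
have [||||w wE wabc] := hitP _ _ _ (clE X' a' b' c' X'E a'E b'E c'E _ _ _ _).
- apply/and5P; split; [exact: lift aa' _ _|exact: lift bb' _ _|
    exact: lift cc' _ _|apply: lift ab _ _ => //; exact: rpredD|].
  apply/and3P; split; [apply: lift ac _ _ => //; exact: rpredD|
    apply: lift bc _ _ => //; exact: rpredD|].
  by apply: lift abc _ _ => //; rewrite !rpredD.
- exact: hlift hab.
- exact: hlift hac.
- exact: hlift hbc.
(* The point [w] found in [E] lies in [sp F + sp Z], so [FE] replaces it by a point of [F] in the
   same class, unless it is in [sp Z], which would put [a + b + c] in [sp X]. *)
have wabc' : w + (a + b + c) \in sp X'.
  exact: memv_hit_trans wabc (ZX' _ abc).
have wF : w \in (sp F + sp Z)%VS.
  have [x xX [z zZ eqz]] := memv_addP (X'P _ wabc').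
  have -> : w = (x + (a + b + c)) + z.
    have -> : x + (a + b + c) + z = (x + z) + (a + b + c) by vec_ring.
    by rewrite -eqz F2_addvK.
  by rewrite memv_add // !rpredD // spXF.
have [wZ|/hitP[w' w'F ww']] := FE w wE wF.
  case/negP: abc0; apply: XP; first by rewrite !rpredD.
  by rewrite -(memv_addr _ (ZX' _ wZ)).
apply/hitP; exists w' => //; apply: XP; first by rewrite !rpredD // mem_sp.
exact: memv_hit_trans (ZX' _ ww') wabc'.
Qed.

End K4.

(** * Linking *)

Section Linking.

Variable n : nat.
Notation V := 'rV['F_2]_n.
Implicit Types (A B P Q S Y Z : {set V}) (U W : {vspace V}).
Implicit Types (a b c g t u v w x y z : V).

(* The condition on the subsets of [Q] says that a single circuit contained in
   [c |: (g |: Q)] contains both [c] and [g]; the second alternative says that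
   [c] and [g] are in different components of [c |: (g |: Y)]. *)
Lemma circuit_or_split Y c g : 0 \notin Y ->
  (exists Q, [/\ Q \subset Y, \sum_(q in Q) q = c + g &
     forall Q', Q' \subset Q -> \sum_(q in Q') q != g]) \/
  (exists Y1 Y2, [/\ Y1 \subset Y, Y2 \subset Y, Y \subset Y1 :|: Y2 &
     forall w, w \in sp (c |: Y1) -> w \in sp (g |: Y2) -> w = 0]).
Proof.
have [m] := ubnP #|Y|; elim: m => // m IH in Y c g *.
move=> ltm0 Y0; move: ltm0; case: (set_0Vmem Y) => [-> _|[y yY]].
  have [g0|g0] := eqVneq g 0.
    right; exists set0, set0; rewrite !sub0set; split=> // w _.
    rewrite setU0 sp1 g0 => /memv_line2.

    by case.
  have [->|cg] := eqVneq c g.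
    left; exists set0; rewrite sub0set big_set0 F2_addvv; split=> // Q'.
    by rewrite subset0 => /eqP->; rewrite big_set0 eq_sym.
  right; exists set0, set0; rewrite !sub0set; split=> // w.
  rewrite !setU0 !sp1 => /memv_line2[]// -> /memv_line2[]// /eqP.
  by rewrite (negPf cg).
rewrite (cardsD1 y) yY ltnS => ltm; set Y' := Y :\ y in ltm *.
have Y'Y : Y' \subset Y by apply: subD1set.
have Y'0 : 0 \notin Y' by apply: contra Y0 => /(subsetP Y'Y).
have yY' : y \notin Y' by rewrite !inE eqxx.
have Yy : Y = y |: Y' by rewrite setD1K.
case: (IH Y' c g ltm Y'0) => [[Q [QY' sQ Qg]]|[Y1 [Y2 [Y1Y' Y2Y' Y'Y12 dir]]]].
  by left; exists Q; split=> //; apply: subset_trans Y'Y.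
have Y1Y := subset_trans Y1Y' Y'Y; have Y2Y := subset_trans Y2Y' Y'Y.
have Y10 : 0 \notin Y1 by apply: contra Y0 => /(subsetP Y1Y).
have Y20 : 0 \notin Y2 by apply: contra Y0 => /(subsetP Y2Y).
have yY1 : y |: Y1 \subset Y by rewrite Yy setUS.
have yY2 : y |: Y2 \subset Y by rewrite Yy setUS.
have in1 u : u \in Y1 -> u \in sp (c |: Y1) by move=> uY; rewrite mem_sp // inE uY orbT.
have in2 u : u \in Y2 -> u \in sp (g |: Y2) by move=> uY; rewrite mem_sp // inE uY orbT.
have c1 : c \in sp (c |: Y1) by rewrite mem_sp ?setU11.
have g2 : g \in sp (g |: Y2) by rewrite mem_sp ?setU11.
have [|yAB] := boolP (y \in (sp (c |: Y1) + sp (g |: Y2))%VS); last first.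
  (* Outside the sum of the two spans, [y] can join one side without creating an intersection. *)
  right; exists (y |: Y1), Y2; split=> //.
    by rewrite Yy -setUA setUS.
  move=> w; rewrite setUCA => /spU1P[|wy w2]; first exact: dir.
  case/negP: yAB; have -> : y = (w + y) + w by vec_ring.
  by rewrite memv_add.
case/memv_addP=> a aA [b bB yab].
have ltY1 : (#|Y1| < m)%N by apply: leq_ltn_trans ltm; apply: subset_leq_card.
have ltY2 : (#|Y2| < m)%N by apply: leq_ltn_trans ltm; apply: subset_leq_card.
(* Now [y = a + b] across the split. Recursion asks for a circuit joining [c] to [a] in [Y1], and
   below for one joining [b] to [g] in [Y2]. If one is missing, the split obtained instead moves a
   part of that side, together with [y], to the other side. *)
case: (IH Y1 c a ltY1 Y10) => [[Q1 [Q1Y sQ1 Q1a]]|[P [P' [PY P'Y YP dirP]]]]; last first.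
  right; exists P, (y |: (P' :|: Y2)); split.
  - exact: subset_trans PY Y1Y.
  - rewrite Yy setUS // subUset Y2Y' andbT; exact: subset_trans P'Y Y1Y'.
  - rewrite Yy setUCA setUS // setUA; apply: subset_trans Y'Y12 _.
    by rewrite setSU.
  move=> w wP; have wA : w \in sp (c |: Y1) by apply: mem_spS wP; rewrite setUS.
  have P'A u : u \in sp P' -> u \in sp (c |: Y1).
    by apply: mem_spS; rewrite subsetU // P'Y orbT.
  have P'a u : u \in sp P' -> u \in sp (a |: P') by apply: spUr.
  have key p u : p \in sp (a |: P') -> p \in sp (c |: Y1) -> u \in sp (g |: Y2) ->
      w = p + u -> w = 0.
    move=> pa pA uB eqw; have u0 : u = 0.
      apply: dir => //; have -> : u = p + w by rewrite eqw; vec_ring.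
      exact: rpredD.
    by apply: dirP => //; rewrite eqw u0 addr0.
  have aP' : a \in sp (a |: P') by rewrite mem_sp ?setU11.
  have gen u : u \in sp (g |: (P' :|: Y2)) ->
      exists p v, [/\ p \in sp P', v \in sp (g |: Y2) & u = p + v].
    by rewrite setUCA => /spUP.
  rewrite [X in sp X]setUCA => /spU1P[] /gen; move=> [p [u [pP' uB eqw]]].
    exact: key (P'a _ pP') (P'A _ pP') uB eqw.
  apply: (key (p + a) (u + b)); [exact: rpredD (P'a _ pP') _|
    exact: rpredD (P'A _ pP') _|exact: rpredD|].
  by rewrite -[w](F2_addvK w y) eqw yab; vec_ring.
case: (IH Y2 b g ltY2 Y20) => [[Q2 [Q2Y sQ2 Q2g]]|[P [P' [PY P'Y YP dirP]]]]; last first.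
  right; exists (y |: (P :|: Y1)), P'; split.
  - rewrite Yy setUS // subUset Y1Y' andbT; exact: subset_trans PY Y2Y'.
  - exact: subset_trans P'Y Y2Y.
  - rewrite Yy -setUA setUS //; apply: subset_trans Y'Y12 _.
    apply/subsetP => u; rewrite !inE => /orP[->|/(subsetP YP)]; rewrite ?orbT //.
    by rewrite inE => /orP[]->; rewrite ?orbT.
  move=> w wL wP; have wB : w \in sp (g |: Y2) by apply: mem_spS wP; rewrite setUS.
  have PB u : u \in sp P -> u \in sp (g |: Y2).
    by apply: mem_spS; rewrite subsetU // PY orbT.
  have Pb u : u \in sp P -> u \in sp (b |: P) by apply: spUr.
  have key p u : p \in sp (b |: P) -> p \in sp (g |: Y2) -> u \in sp (c |: Y1) ->
      w = p + u -> w = 0.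
    move=> pa pA uB eqw; have u0 : u = 0.
      apply: dir => //; have -> : u = p + w by rewrite eqw; vec_ring.
      exact: rpredD.
    by apply: dirP => //; rewrite eqw u0 addr0.
  have bP : b \in sp (b |: P) by rewrite mem_sp ?setU11.
  have gen u : u \in sp (c |: (P :|: Y1)) ->
      exists p v, [/\ p \in sp P, v \in sp (c |: Y1) & u = p + v].
    by rewrite setUCA => /spUP.
  move: wL; rewrite [X in sp X]setUCA => /spU1P[] /gen; move=> [p [u [pP uA eqw]]].
    exact: key (Pb _ pP) (PB _ pP) uA eqw.
  apply: (key (p + b) (u + a)); [exact: rpredD (Pb _ pP) _|
    exact: rpredD (PB _ pP) _|exact: rpredD|].
  by rewrite -[w](F2_addvK w y) eqw yab; vec_ring.
have disj : [disjoint Q1 & Q2].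
  apply/pred0P => u /=; apply/negP => /andP[u1 u2].
  have u0 : u = 0.
    by apply: dir; [rewrite in1 // (subsetP Q1Y)|rewrite in2 // (subsetP Q2Y)].
  by case/negP: Y0; rewrite -u0 (subsetP Y1Y) // (subsetP Q1Y).
have sum12 (R1 R2 : {set V}) : R1 \subset Q1 -> R2 \subset Q2 ->
    \sum_(q in R1 :|: R2) q = \sum_(q in R1) q + \sum_(q in R2) q.
  move=> R1Q R2Q; rewrite -bigU /=; last exact: disjointW disj.
  by apply: eq_bigl => u; rewrite !inE.
have Q12Y' : Q1 :|: Q2 \subset Y'.
  by rewrite subUset (subset_trans Q1Y) // (subset_trans Q2Y).
have yQ12 : y \notin Q1 :|: Q2 by apply: contra yY' => /(subsetP Q12Y').
(* The two circuits are glued at [y]: [(c + a) + (b + g) + y = c + g]. *)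
left; exists (y |: (Q1 :|: Q2)); split; first by rewrite Yy setUS.
  by rewrite big_setU1 //= sum12 // sQ1 sQ2 yab; vec_ring.
move=> Q' Q'Q.
pose R1 := Q' :&: Q1; pose R2 := Q' :&: Q2.
have [R1Q R2Q] : R1 \subset Q1 /\ R2 \subset Q2 by rewrite !subsetIr.
have R1A : \sum_(q in R1) q \in sp (c |: Y1).
  exact: spUr (sum_sp (subset_trans R1Q Q1Y)).
have R2B : \sum_(q in R2) q \in sp (g |: Y2).
  exact: spUr (sum_sp (subset_trans R2Q Q2Y)).
have R12 : Q' :\ y = R1 :|: R2.
  apply/setP => u; rewrite !inE -andb_orr.
  have [->|uy] /= := eqVneq u y.
    by move: yQ12; rewrite inE => /negPf->; rewrite andbF.
  case: (boolP (u \in Q')) => // /(subsetP Q'Q).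
  by rewrite !inE (negPf uy) /= => ->.
(* A subset summing to [g] is compared in the two spans, which meet in 0: if it contains [y], its
   part in [Q1] sums to [a]; otherwise its part in [Q2] sums to [g]. Both are excluded. *)
apply/eqP => sQ'.
have [yQ'|yQ'] := boolP (y \in Q').
  move: sQ'; rewrite (big_setD1 y) //= R12 sum12 // yab => eqg.
  case/eqP: (Q1a R1 R1Q); apply/eqP; rewrite -F2_addv_eq0; apply/eqP.
  apply: dir; first exact: rpredD.
  have -> : \sum_(q in R1) q + a = \sum_(q in R2) q + b + g.
    by rewrite -eqg; vec_ring.
  by rewrite !rpredD.
have Q'12 : Q' = R1 :|: R2.
  rewrite -R12; apply/setP => u; rewrite !inE.
  by have [->|] := eqVneq u y; rewrite // (negPf yQ').
case/eqP: (Q2g R2 R2Q); apply/eqP; rewrite -F2_addv_eq0; apply/eqP.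
apply: dir; last exact: rpredD.
have -> : \sum_(q in R2) q + g = \sum_(q in R1) q.
  by rewrite -sQ' Q'12 sum12 //; vec_ring.
by [].
Qed.


Lemma mem_sp2 c t l : l \in sp [set c; t] -> [\/ l = 0, l = c, l = t | l = t + c].
Proof.
case/spU1P; rewrite sp1 => /memv_line2[]; first by move=> ->; constructor 1.
- by move=> ->; constructor 3.
- by move=> /eqP; rewrite F2_addv_eq0 => /eqP->; constructor 2.
by move=> h; constructor 4; rewrite -h F2_addvK.
Qed.

Lemma dim_sp2 c t : c != 0 -> t != 0 -> t != c -> \dim (sp [set c; t]) = 2.
Proof.
move=> c0 t0 tc; apply/eqP; rewrite eqn_leq; apply/andP; split.
  by apply: leq_trans (dim_sp _) _; rewrite cards2; case: (_ != _).
have h : (<[c]> + <[t]> <= sp [set c; t])%VS.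
  by rewrite subv_add -!memvE !mem_sp // !inE eqxx ?orbT.
apply: leq_trans (dimvS h); rewrite dimv_disjoint_sum.
  by rewrite !dim_vline c0 t0.
apply/eqP; rewrite -subv0; apply/subvP => w; rewrite memv_cap memv0.
case/andP => /memv_line2[->//|->] /memv_line2[/eqP|/esym/eqP].
  by rewrite (negPf c0).
by rewrite (negPf tc).
Qed.

(* Contracting [Z] maps [Y] onto the line [{c, t, t + c}], covering at least
   [t] and [t + c].  Among the [Z] for which one of these two points [g] is
   covered, choose one minimizing [#|Q :\: Z|], where the circuit through [c]
   and [g] in [Y] is [c |: (g |: Q)]; if [g + c] is not covered, then exchanging
   an element of [Q] with an element of [Z :\: Q] decreases this number. *)
Lemma linking Y c t :
  0 \notin Y -> c != 0 -> t != 0 -> t != c -> c \in sp Y -> t \in sp Y ->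
  (forall g Y1 Y2, g = t \/ g = t + c -> Y1 \subset Y -> Y2 \subset Y ->
     Y \subset Y1 :|: Y2 ->
     ~ (forall w, w \in sp (c |: Y1) -> w \in sp (g |: Y2) -> w = 0)) ->
  exists Z, [/\ Z \subset Y,
    forall w, w \in Y -> exists2 l, l \in sp [set c; t] & w + l \in sp Z,
    forall l, l \in sp [set c; t] -> l \in sp Z -> l = 0,
    hit Y (sp Z) t & hit Y (sp Z) (t + c)].
Proof.
move=> Y0 c0 t0 tc cY tY conn; pose L := sp [set c; t].
have LY : (L <= sp Y)%VS.
  by apply: sp_sub => v; rewrite !inE => /orP[] /eqP->.
have [cL tL] : c \in L /\ t \in L by rewrite !mem_sp // !inE eqxx ?orbT.
have dimL : \dim L = 2 by apply: dim_sp2.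
have dimL_le : (\dim L <= 2)%N by rewrite dimL.
(* The bound on [#|Z|] forces [Z] to be independent and [sp Z] to be a complement of [L] in [sp Y],
   so every point of [Y] has a unique image in [L]. *)
pose valid Z := [&& Z \subset Y, (#|Z| + 2 <= \dim (sp Y))%N &
                    (sp Y <= sp Z + L)%VS].
have [Z0 vZ0] : exists Z, valid Z.
  pose P Z := (Z \subset Y) && (#|Z| + 2 <= \dim (sp Z + L))%N.
  have P0 : P set0 by rewrite /P sub0set cards0 sp0 add0v dimL.
  case: (@arg_maxnP _ set0 P (fun Z => #|Z|) P0) => Z /andP[ZY dimZ] maxZ.
  have YZ : (sp Y <= sp Z + L)%VS.
    apply: sp_sub => y yY; apply/negPn/negP => yZ.
    have ynZ : y \notin Z.
      by apply: contra yZ => /mem_sp; apply/subvP; rewrite addvSl.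
    have ZyZ : (sp Z + L <= sp (y |: Z) + L)%VS.
      by rewrite addvS // spS // subsetUr.
    suff /maxZ : P (y |: Z) by rewrite /= cardsU1 ynZ add1n ltnn.
    rewrite /P subUset sub1set yY ZY cardsU1 ynZ /= addSn.
    apply: leq_ltn_trans dimZ _; rewrite ltnNge; apply: contra yZ => le.
    have /eqP-> : (sp Z + L == sp (y |: Z) + L)%VS by rewrite eqEdim ZyZ.
    by rewrite (subvP (addvSl _ _)) // mem_sp // setU11.
  exists Z; rewrite /valid ZY YZ andbT /=; apply: leq_trans dimZ _.
  by apply: dimvS; rewrite subv_add spS.
have validL Z l : valid Z -> l \in L -> l \in sp Z -> l = 0.
  case/and3P => ZY dimZ YZ lL lZ.
  have : (\dim (sp Z :&: L) <= 0)%N.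
    rewrite -(leq_add2l (\dim (sp Z + L))) dimv_sum_cap addn0.
    apply: leq_trans (leq_add (dim_sp Z) dimL_le) _.
    exact: leq_trans dimZ (dimvS YZ).
  rewrite leqn0 dimv_eq0 => /eqP cap0; apply/eqP.
  by rewrite -memv0 -cap0 memv_cap lZ.
have validY Z w : valid Z -> w \in Y -> exists2 l, l \in L & w + l \in sp Z.
  case/and3P => _ _ YZ /mem_sp/(subvP YZ)/memv_addP[z zZ [l lL ->]].
  by exists l; rewrite ?F2_addvK.
(* By dimension, some point of [Y] has an image other than 0 and [c]; this image, [t] or [t + c],
   becomes [g]. *)
have [y yY yZ] : exists2 y, y \in Y & y \notin (sp Z0 + <[c]>)%VS.
  apply/exists_inP; rewrite -negb_forall_in; apply/negP => /forall_inP h.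
  have YZ : (sp Y <= sp Z0 + <[c]>)%VS by apply: sp_sub.
  case/and3P: vZ0 => _ dimZ _.
  have dc : (\dim <[c]> <= 1)%N by rewrite dim_vline leq_b1.
  have := leq_trans dimZ (leq_trans (dimvS YZ) (leq_trans
    (dimv_add_leqif (sp Z0) <[c]>).1 (leq_add (dim_sp Z0) dc))).
  by rewrite leq_add2l.
have [g gtc yg] : exists2 g, g = t \/ g = t + c & y + g \in sp Z0.
  have [l lL yl] := validY _ _ vZ0 yY.
  have zc z : z \in sp Z0 -> z \in (sp Z0 + <[c]>)%VS.
    by apply: (subvP (addvSl _ _)).
  have cc : c \in (sp Z0 + <[c]>)%VS by rewrite (subvP (addvSr _ _)) ?memv_line.
  case: (mem_sp2 lL) => eql; rewrite eql in yl; last 2 first.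
  - by exists t; [left|].
  - by exists (t + c); [right|].
  - by case/negP: yZ; rewrite -[y]addr0 zc.
  by case/negP: yZ; rewrite -(memv_addl _ cc) zc.
have gL : g \in L by case: gtc => ->; rewrite ?rpredD.
have g0 : g != 0 by case: gtc => -> //; rewrite F2_addv_eq0.
have gc : c != g.
  case: gtc => ->; first by rewrite eq_sym.
  by rewrite -F2_addv_eq0 addrC F2_addvK.
case: (circuit_or_split c g Y0) => [[Q [QY sQ Qg]]|[Y1 [Y2 [Y1Y Y2Y YY dir]]]];
  last by case: (conn g Y1 Y2).
pose P Z := valid Z && hit Y (sp Z) g.
have P0 : P Z0 by rewrite /P vZ0; apply/hitP; exists y.
case: (@arg_minnP _ Z0 P (fun Z => #|Q :\: Z|) P0) => Z /andP[vZ hg] minZ.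
have ZY : Z \subset Y by case/and3P: vZ.
suff hcg : hit Y (sp Z) (c + g).
  exists Z; split.
  - exact: ZY.
  - by move=> w; apply: validY.
  - by move=> l; apply: validL.
  - case: gtc => eqg; first by rewrite -eqg.
    by move: hcg; rewrite eqg [c + _]addrC F2_addvK.
  - case: gtc => eqg; last by rewrite -eqg.
    by rewrite -eqg addrC.
apply: contraT => nh.
(* As [c + g] is not covered, if no point of [Q] had image [g], then all would have image 0 or [c],
   whereas [Q] sums to [c + g]. *)
have [w wQ wg] : exists2 w, w \in Q & w + g \in sp Z.
  apply/exists_inP; apply: contraT => /exists_inPn nw.
  have : c + g \in (sp Z + <[c]>)%VS.
    rewrite -sQ; apply: rpred_sum => q qQ; have qY := subsetP QY q qQ.
    have [l lL ql] := validY _ _ vZ qY.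
    have zc z : z \in sp Z -> z \in (sp Z + <[c]>)%VS.
      by apply: (subvP (addvSl _ _)).
    have cc : c \in (sp Z + <[c]>)%VS.
      by rewrite (subvP (addvSr _ _)) ?memv_line.
    have lE : [\/ l = 0, l = c, l = g | l = c + g].
      case: (mem_sp2 lL) gtc => -> [] ->;
        try by [constructor 1|constructor 2|constructor 3].
      - by constructor 4; rewrite addrC F2_addvK.
      - by constructor 4; rewrite addrC.
    case: lE => eql; rewrite eql in ql.
    - by rewrite -[q]addr0 zc.
    - by rewrite -(memv_addl _ cc) zc.
    - by case/negP: (nw q qQ).
    - by case/negP: nh; apply/hitP; exists q.
  case/memv_addline => h.
    have := validL _ _ vZ _ h; rewrite rpredD // => /(_ isT)/eqP.
    by rewrite F2_addv_eq0 (negPf gc).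
  move: h; rewrite addrC addrA F2_addvv add0r => /(validL _ _ vZ gL)/eqP.
  by rewrite (negPf g0).
have wY := subsetP QY w wQ.
have wZ : w \notin sp Z.
  apply/negP => wZ; case/eqP: g0; apply: (validL _ _ vZ gL).
  by rewrite -(memv_addr _ wZ).
have [S SZ eqS] := spP wg.
(* Some [z] in [S] is outside [Q], since otherwise [w |: S] would be a subset of [Q] summing to [g].
   Exchanging [z] for [w] keeps [g] covered, now by [z], and decreases [#|Q :\: Z|]. *)
have [|/subsetPn[z zS zQ]] := boolP (S \subset Q).
  move=> SQ; have wSQ : w |: S \subset Q by rewrite subUset sub1set wQ.
  case/eqP: (Qg _ wSQ).
  rewrite big_setU1 /= -?eqS; last first.
    by apply: contra wZ => /(subsetP SZ)/mem_sp.
  by rewrite addrA F2_addvv add0r.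
have zZ := subsetP SZ z zS.
pose Z' := w |: (Z :\ z).
have zE : z + g \in sp Z'.
  have -> : z + g = w + \sum_(q in S :\ z) q.
    have h : w + g = z + \sum_(q in S :\ z) q by rewrite eqS (big_setD1 z).
    rewrite -[X in _ = X + _](F2_addvK _ g) h.
    by move: (\sum_(q in _) q) => s; vec_ring.
  apply: rpredD; first by rewrite mem_sp ?setU11.
  by apply: spUr; apply: sum_sp; rewrite setSD.
have vZ' : valid Z'.
  case/and3P: vZ => _ dimZ YZ; apply/and3P; split.
  - by rewrite subUset sub1set wY (subset_trans (subD1set _ _)).
  - rewrite cardsU1 !inE negb_and.
    have -> : w \notin Z by apply: contra wZ => /mem_sp.
    by rewrite orbT; move: dimZ; rewrite (cardsD1 z) zZ.
  apply: subv_trans YZ _; rewrite subv_add addvSr andbT.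
  apply: sp_sub => u uZ; have [->|uz] := eqVneq u z.
    by rewrite -[z](F2_addvK _ g) memv_add.
  rewrite (subvP (addvSl _ _)) // mem_sp // !inE uz uZ orbT //.
have /minZ : P Z'.
  by rewrite /P vZ'; apply/hitP; exists z => //; apply: (subsetP ZY).
rewrite leqNgt => /negP[]; apply: proper_card; apply/properP; split.
  apply/subsetP => u; rewrite !inE negb_or negb_and negbK => /andP[].
  case/andP => _ /orP[/eqP->|-> //]; by rewrite (negPf zQ).
exists w; rewrite !inE ?eqxx //= wQ andbT.
by apply: contra wZ => /mem_sp.
Qed.

End Linking.

(** * Contracting a point *)

Section Contraction.

Variable n : nat.
Notation V := 'rV['F_2]_n.
Implicit Types (A B E F N S X Y Z : {set V}) (U H : {vspace V}).
Implicit Types (c e g l s t u v w x y z : V).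

(* Over F_2, a subspace of dimension at most 1 is some [{0, t}]. *)
Definition separates S S' t : Prop :=
  forall w, w \in sp S -> w \in sp S' -> w = 0 \/ w = t.

(* The second clause only matters for sets with at most three points. *)
Definition conn3 E : Prop :=
  (forall S t, S \subset E -> separates S (E :\: S) t ->
     (#|S| <= 1)%N \/ (#|E :\: S| <= 1)%N) /\
  (forall x, x \in E -> E != [set x] -> x \in sp (E :\ x)).

Definition thin E e : Prop :=
  [/\ 0 \notin E, e \in E, K4_closed E & K4_closed (E :\ e)].

(** The last hypothesis says that [e] is alone in its class modulo [sp Z]. Hence [F :\ e] arises
    from [E :\ e] as [F] does from [E], and [K4_closed_minor] applies to both pairs. *)
Lemma thin_minor E F e Z :
  thin E e -> 0 \notin F -> e \in F -> Z \subset E :\ e ->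
  (forall v, v \in F -> hit E (sp Z) v) ->
  (forall w, w \in E -> w \in (sp F + sp Z)%VS ->
     w \in sp Z \/ hit F (sp Z) w) ->
  (forall v, v \in sp F -> v \in sp Z -> v = 0) ->
  (forall w, w \in E -> w != e -> w + e \notin sp Z) ->
  thin F e.
Proof.
move=> [E0 eE clE clEe] F0 eF ZE EF FE FZ nop; split=> //.
  by apply: K4_closed_minor EF FE FZ clE; apply: subset_trans ZE (subD1set _ _).
apply: K4_closed_minor ZE _ _ _ clEe.
- move=> v; rewrite !inE => /andP[ve vF].
  have [w wE wv] := hitP _ _ _ (EF v vF).
  apply/hitP; exists w => //; rewrite !inE wE andbT.
  apply/eqP => we; case/eqP: ve; apply/eqP; rewrite eq_sym -F2_addv_eq0.
  apply/eqP; apply: FZ; first by rewrite rpredD // mem_sp.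
  by rewrite -we.
- move=> w; rewrite !inE => /andP[we wE] wF.
  have wF' : w \in (sp F + sp Z)%VS.
    by apply: subvP wF; rewrite addvS // spS // subD1set.
  have [|/hitP[v vF vw]] := FE w wE wF'; first by left.
  right; apply/hitP; exists v => //; rewrite !inE vF andbT.
  by apply/eqP => ve; case/negP: (nop w wE we); rewrite addrC -ve.
by move=> v /(mem_spS (subD1set _ _)); apply: FZ.
Qed.

Lemma conn3_partition E S S' t :
  conn3 E -> E = S :|: S' -> [disjoint S & S'] -> separates S S' t ->
  (#|S| <= 1)%N \/ (#|S'| <= 1)%N.
Proof.
move=> [conn _] eqE dis sep; have ES' : E :\: S = S'.
  by rewrite eqE setDUl setDv set0U; apply/setDidPl; rewrite disjoint_sym.
have [] := conn S t; rewrite ?ES' //; first by rewrite eqE subsetUl.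
  by left.
by right.
Qed.

(* The simplification of the contraction of [c], each class [{v, v + c}] being
   represented by its element in a hyperplane [H] that avoids [c]. *)
Definition contr E c H : {set V} :=
  [set v | [&& v \in H, v != 0 & (v \in E) || (v + c \in E)]].

(** The preimage of [S] under contraction of [c]. For [S] inside [contr E c H] it does not contain
    [c], which is contracted to 0. *)
Definition unfold_class E c S : {set V} :=
  [set w in E | (w \in S) || (w + c \in S)].

Section Hyperplane.

Variables (E : {set V}) (c : V) (H : {vspace V}).
Hypotheses (cH : c \notin H) (HV : forall v, v \in H \/ v + c \in H).
Hypotheses (E0 : 0 \notin E) (cE : c \in E).

Notation lift := (unfold_class E c).

Lemma contr_H v : v \in contr E c H -> v \in H.
Proof. by rewrite inE => /and3P[]. Qed.

Lemma sp_contr_H S v : S \subset contr E c H -> v \in sp S -> v \in H.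
Proof.
by move=> /subsetP SE; apply/subvP/sp_sub => u /SE/contr_H.
Qed.

Lemma mem_H_addc v : v \in H -> v + c \in H -> False.
Proof. by move=> vH; rewrite memv_addr // (negPf cH). Qed.

Lemma contr_rep w : w \in E -> w != c ->
  exists2 v, v \in contr E c H & v = w \/ v = w + c.
Proof.
move=> wE wc; have [wH|wH] := HV w.
  exists w; last by left.
  by rewrite inE wH wE /= andbT; apply: contraNneq E0 => <-.
exists (w + c); last by right.
by rewrite inE wH F2_addvK wE orbT andbT F2_addv_eq0.
Qed.

Lemma contr0 : 0 \notin contr E c H.
Proof. by rewrite inE eqxx andbF. Qed.

Lemma lift_sub S : lift S \subset E.
Proof. by apply/subsetP => w; rewrite inE => /andP[]. Qed.

Lemma lift_c S : S \subset contr E c H -> c \notin lift S.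
Proof.
move=> SE; rewrite inE cE F2_addvv /= negb_or; apply/andP; split.
  by apply/negP => /(subsetP SE)/contr_H; rewrite (negPf cH).
by apply/negP => /(subsetP SE); rewrite (negPf contr0).
Qed.

Lemma lift_cover S : S \subset contr E c H ->
  E = c |: (lift S :|: lift (contr E c H :\: S)).
Proof.
move=> SE; apply/setP => w; rewrite in_setU1 in_setU.
have [->|wc] /= := eqVneq w c; first by rewrite cE.
rewrite [w \in lift S]inE [w \in lift _]inE -andb_orr.
case: (boolP (w \in E)) => //= wE; have [v vE vw] := contr_rep wE wc.
rewrite !in_setD; have [vS|vS] := boolP (v \in S).
  by case: vw vS => -> ->; rewrite ?orbT.
by case: vw => eqv; rewrite eqv in vE vS; rewrite vS vE ?orbT.
Qed.

Lemma lift_disjoint S : S \subset contr E c H ->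
  [disjoint lift S & lift (contr E c H :\: S)].
Proof.
move=> SE; apply/pred0P => w /=; apply/negP => /andP[].
have SH u : u \in S -> u \in H by move/(subsetP SE)/contr_H.
have SH' u : u \in contr E c H :\: S -> u \in H by case/setDP => /contr_H.
rewrite [w \in lift S]inE [w \in lift _]inE => /andP[_ wS] /andP[_ wS'].
case/orP: wS => wS; case/orP: wS' => wS'.
- by move: wS'; rewrite inE wS.
- exact: mem_H_addc (SH _ wS) (SH' _ wS').
- exact: mem_H_addc (SH' _ wS') (SH _ wS).
- by move: wS'; rewrite inE wS.
Qed.

Lemma card_lift S : S \subset contr E c H -> (#|S| <= #|lift S|)%N.
Proof.
move=> SE; pose f w := if w \in S then w else w + c.
apply: leq_trans (leq_imset_card f (lift S)); apply: subset_leq_card.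
apply/subsetP => s sS; have := subsetP SE s sS.
rewrite inE => /and3P[sH s0 /orP[sE|sE]]; apply/imsetP.
  by exists s; rewrite /f ?sS // inE sE sS.
exists (s + c); first by rewrite inE sE F2_addvK sS orbT.
rewrite /f; case: ifP; last by rewrite F2_addvK.
by move/(subsetP SE)/contr_H => /(mem_H_addc sH).
Qed.

Lemma sp_lift S w : w \in sp (c |: lift S) -> w \in sp S \/ w + c \in sp S.
Proof.
move=> h; apply: memv_addline; apply: subvP h; apply: sp_sub => v.
have cc : c \in (sp S + <[c]>)%VS by rewrite (subvP (addvSr _ _)) ?memv_line.
have SS u : u \in S -> u \in (sp S + <[c]>)%VS.
  by move/mem_sp; apply: (subvP (addvSl _ _)).
rewrite !inE => /orP[/eqP-> //|/andP[_ /orP[/SS //|/SS]]].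
by rewrite memv_addl.
Qed.

Lemma sp_sub_lift S w : S \subset contr E c H -> w \in sp S ->
  w \in sp (c |: lift S).
Proof.
move=> SE; apply/subvP/sp_sub => s sS; have := subsetP SE s sS.
rewrite inE => /and3P[sH s0 /orP[sE|sE]].
  by rewrite mem_sp // !inE sE sS orbT.
have cc : c \in sp (c |: lift S) by rewrite mem_sp ?setU11.
by rewrite -(memv_addl _ cc) mem_sp // !inE sE F2_addvK sS !orbT.
Qed.

(** Only one of [w] and [w + c] is in [H], so reducing modulo [c] gives the same vector on both
    sides. Thus lifting enlarges the intersection of two spans by [c] alone. *)
Lemma sp_lift_cap S S' w :
  S \subset contr E c H -> S' \subset contr E c H ->
  w \in sp (c |: lift S) -> w \in sp (c |: lift S') ->
  exists u, [/\ u \in sp S, u \in sp S' & w = u \/ w = u + c].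
Proof.
move=> SE S'E /sp_lift wS /sp_lift wS'.
have SH := sp_contr_H SE; have SH' := sp_contr_H S'E.
case: wS wS' => wS [wS'|wS'].
- by exists w; split=> //; left.
- by case: (mem_H_addc (SH _ wS) (SH' _ wS')).
- by case: (mem_H_addc (SH' _ wS') (SH _ wS)).
- by exists (w + c); split=> //; right; rewrite F2_addvK.
Qed.

(** Spans that meet in 0 after contraction lift to spans that meet in [{0, c}]. Adding [c] to either
    side in turn bounds both lifts by one point, and the small set that is left has a coloop. *)
Lemma contr_connected S : conn3 E -> S \subset contr E c H ->
  (forall w, w \in sp S -> w \in sp (contr E c H :\: S) -> w = 0) ->
  S = set0 \/ contr E c H :\: S = set0.
Proof.
move=> conE SE dir; set S' := _ :\: _ in dir *.
have S'E : S' \subset contr E c H by apply: subsetDl.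
have [->|[s sS]] := set_0Vmem S; first by left.
have [->|[s' sS']] := set_0Vmem S'; first by right.
have card_gt0 A (a : V) : A \subset contr E c H -> a \in A -> (0 < #|lift A|)%N.
  by move=> /card_lift h aA; apply: leq_trans h; apply/card_gt0P; exists a.
have capc w : w \in sp (c |: lift S) -> w \in sp (c |: lift S') ->
    w = 0 \/ w = c.
  move=> wS wS'; have [u [uS uS' ]] := sp_lift_cap SE S'E wS wS'.
  by rewrite (dir u uS uS') add0r.
have le A A' : A \subset contr E c H -> (0 < #|lift A|)%N ->
    E = (c |: lift A) :|: lift A' -> [disjoint c |: lift A & lift A'] ->
    separates (c |: lift A) (lift A') c -> (#|lift A'| <= 1)%N.
  move=> AE A0 eqE dis sep; case: (conn3_partition conE eqE dis sep) => //.
  by rewrite cardsU1 lift_c // add1n ltnS leqNgt A0.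
have le2 : (#|lift S'| <= 1)%N.
  apply: (le S) => //; first exact: card_gt0 sS.
  - by rewrite -setUA; apply: lift_cover.
  - by rewrite disjointsU1 lift_c //= lift_disjoint.
  by move=> w wS /(mem_spS (subsetUr [set c] _)); apply: capc.
have le1 : (#|lift S| <= 1)%N.
  apply: (le S') => //; first exact: card_gt0 sS'.
  - by rewrite -setUA [lift S' :|: _]setUC; apply: lift_cover.
  - by rewrite disjointsU1 lift_c //= disjoint_sym lift_disjoint.
  by move=> w wS /(mem_spS (subsetUr [set c] _)) /capc; apply.
have [w1 w1S] := card_gt0P (card_gt0 _ _ SE sS).
have eq1 : lift S = [set w1].
  by apply/esym/eqP; rewrite eqEcard sub1set w1S cards1.
have Ew1 : E :\ w1 = c |: lift S'.
  rewrite [X in X :\ _](lift_cover SE) eq1 setUCA setDUl setDv set0U.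
  apply/setDidPl; rewrite disjoint_sym disjoints1 in_setU1 negb_or.
  have := lift_c SE; rewrite eq1 inE eq_sym => -> /=.
  by have := lift_disjoint SE; rewrite eq1 disjoints1.
have w1E := subsetP (lift_sub S) _ w1S.
have : w1 \in sp (E :\ w1).
  case: conE => _; apply => //; apply/eqP => eqE.
  have := lift_c SE; rewrite eq1 inE => /negP[].
  by move: cE; rewrite {1}eqE inE.
rewrite Ew1 => /capc[]; first by rewrite spUr ?mem_sp.
  by move=> w10; move: E0; rewrite -w10 w1E.
by move=> w1c; move: (lift_c SE); rewrite eq1 inE w1c eqxx.
Qed.

End Hyperplane.

End Contraction.

(** * Replacing one side of a 3-separation by a line *)

Section Reduction.

Variable n : nat.
Notation V := 'rV['F_2]_n.
Implicit Types (A B E F N S X Y Z : {set V}) (U H : {vspace V}).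
Implicit Types (c e g l s t u v w x y z : V).

Section Triangle.

Variables (E X Y : {set V}) (c t : V).
Hypotheses (conE : conn3 E) (E0 : 0 \notin E).
Hypotheses (EXY : E = c |: (X :|: Y)) (dXY : [disjoint X & Y]).
Hypotheses (c0 : c != 0) (t0 : t != 0) (tc : t != c).
Hypotheses (cX : c \in sp X) (tX : t \in sp X) (cY : c \in sp Y).
Hypothesis capXY : forall w, w \in sp X -> w \in sp Y -> w \in sp [set c; t].
Hypothesis Y_gt1 : (1 < #|Y|)%N.

Notation L := [set c; t; t + c].
Notation N := (X :|: L).

Let ctL : [set c; t] \subset L.
Proof. exact: subsetUl. Qed.

Let L_two l1 l2 A : l1 \in L -> l2 \in L -> l1 != l2 -> l1 \in A -> l2 \in A ->
  (forall w, w \in sp [set c; t] -> w \in sp A) /\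
  (forall l, l \in L -> l \notin A -> l = l1 + l2).
Proof.
move=> l1L l2L l12 l1A l2A.
have third l : l \in L -> [\/ l = l1, l = l2 | l = l1 + l2].
  move: l12; rewrite !inE in l1L l2L * => l12.
  case/orP: l1L => [/orP[]|] /eqP e1; case/orP: l2L => [/orP[]|] /eqP e2;
    rewrite e1 e2 ?eqxx // in l12 *;
    case/orP=> [/orP[]|] /eqP->;
    (try by [constructor 1|constructor 2]); constructor 3; vec_ring.
split=> [w|l lL lA]; last first.
  by case: (third l lL) => // eql; rewrite eql ?l1A ?l2A in lA.
move=> /(mem_spS ctL); apply/subvP/sp_sub => l /third[] -> //; last rewrite rpredD //.
all: exact: mem_sp.
Qed.

Let XE : X \subset E.
Proof. by rewrite EXY subsetU // subsetUl orbT. Qed.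

Let sp_decomp (R : {set V}) w : R \subset X -> w \in sp (E :\: R) ->
  exists x y, [/\ x \in sp (X :\: R), y \in sp Y & w = x + y].
Proof.
move=> RX wR; have /spUP[x [y [xX yY ->]]] : w \in sp ((X :\: R) :|: (c |: Y)).
  apply: mem_spS wR; rewrite {1}EXY; apply/subsetP => v; rewrite !inE.
  by case/andP=> -> /or3P[] ->; rewrite ?orbT.
exists x, y; split=> //; apply: subvP yY; apply: sp_sub => v.
by rewrite in_setU1 => /orP[/eqP->|/mem_sp].
Qed.

Let no_coloop x : x \in X -> x != c -> x \in sp (E :\ x).
Proof.
move=> xX xc; case: conE => _; apply; first exact: (subsetP XE).
apply/eqP => Ex; have : c \in E by rewrite EXY setU11.
by rewrite Ex inE eq_sym (negPf xc).
Qed.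

(** Since [S] spans [L], the sets [R = S' :\: L] and [E :\: R] meet only inside [sp S] and [sp S'],
    and 3-connectedness of [E] leaves at most one point in [R]. If [R] is a point [f] and [S'] also
    has a point of [L], then both points are in both spans ([f] is not a coloop of [E]), so both
    equal [s], although [f] is not in [L]. *)
Let conn3_triangle_side S S' s l1 l2 :
  N = S :|: S' -> [disjoint S & S'] -> separates S S' s ->
  l1 \in L -> l2 \in L -> l1 != l2 -> l1 \in S -> l2 \in S -> (#|S'| <= 1)%N.
Proof.
move=> NS dS sep l1L l2L l12 l1S l2S.
have [LS LS'] := L_two l1L l2L l12 l1S l2S.
have LSm l : l \in L -> l \in sp S.
  move=> lL; apply: LS; move: lL; rewrite in_setU => /orP[/mem_sp //|].
  by rewrite inE => /eqP->; rewrite rpredD // mem_sp // !inE eqxx ?orbT.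
pose R := S' :\: L.
have RX : R \subset X.
  apply/subsetP => v /setDP[vS' vL]; have : v \in N by rewrite NS inE vS' orbT.
  by rewrite in_setU (negPf vL) orbF.
have capR w : w \in sp R -> w \in sp (E :\: R) -> w \in sp S /\ w \in sp S'.
  move=> wR /(sp_decomp RX)[x [y [xX yY wxy]]].
  split; last by apply: mem_spS wR; apply: subsetDl.
  have xS : x \in sp S.
    apply: subvP xX; apply: sp_sub => v /setDP[vX vR].
    have : v \in N by rewrite inE vX.
    rewrite NS inE => /orP[/mem_sp //|vS']; apply: LSm.
    by move: vR; rewrite in_setD vS' andbT negbK.
  rewrite wxy rpredD // LS //; apply: capXY => //.
  have -> : y = w + x by rewrite wxy; vec_ring.
  by rewrite rpredD // ?(mem_spS RX wR) // (mem_spS _ xX) // subsetDl.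
have R1 : (#|R| <= 1)%N.
  have sepR : separates R (E :\: R) s.
    by move=> w wR /(capR _ wR)[]; apply: sep.
  case: conE => /(_ R s) [||//|]; rewrite ?(subset_trans RX) // => h _.
  move: Y_gt1; rewrite ltnNge => /negP[]; apply: leq_trans h.
  apply: subset_leq_card; apply/subsetP => v vY.
  rewrite in_setD EXY !in_setU vY !orbT andbT; apply/negP => /(subsetP RX) vX.
  by rewrite (disjointFr dXY vX) in vY.
have [h0|[l]] := set_0Vmem (S' :&: L).
  by rewrite -(setID S' L) h0 set0U.
case/setIP => lS' lL.
have lS : l \notin S by rewrite (disjointFl dS lS').
have [R0|[f fR]] := set_0Vmem R.
  apply: leq_trans (_ : #|[set l]| <= 1)%N; last by rewrite cards1.
  apply: subset_leq_card; apply/subsetP => v vS'; rewrite inE.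
  have vL : v \in L.
    apply: contraT => vL; have : v \in R by rewrite in_setD vL.
    by rewrite R0 inE.
  have vS : v \notin S by rewrite (disjointFl dS vS').
  by rewrite (LS' v vL vS) (LS' l lL lS).
have Rf : R = [set f] by apply/esym/eqP; rewrite eqEcard sub1set fR cards1.
have fX := subsetP RX f fR.
have fL : f \notin L by case/setDP: fR.
have fc : f != c by apply: contraNneq fL => ->; rewrite !inE eqxx.
have := no_coloop fX fc; rewrite -Rf => /capR[].
  by rewrite mem_sp.
move=> fS fS'.
have l0 : l != 0.
  move: lL; rewrite !inE => /orP[/orP[]|] /eqP-> //.
  by rewrite F2_addv_eq0.
have f0 : f != 0 by apply: contraNneq E0 => <-; apply: (subsetP XE).
have [l_0|ls] := sep l (LSm l lL) (mem_sp lS'); first by rewrite l_0 eqxx in l0.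
have [f_0|fs] := sep f fS fS'; first by rewrite f_0 eqxx in f0.
by move: fL; rewrite fs -ls lL.
Qed.

(** By pigeonhole, two of the three points of [L] are on the same side of a partition of [N], which
    is the case of [conn3_triangle_side]. The set [N] is what contracting [Y] onto the line common
    to both sides will leave. *)
Lemma conn3_triangle : conn3 N.
Proof.
have cL : c \in L by rewrite !inE eqxx.
have tL : t \in L by rewrite !inE eqxx orbT.
have tcL : t + c \in L by rewrite !inE eqxx orbT.
have c_t : c != t by rewrite eq_sym.
have c_tc : c != t + c by rewrite -F2_addv_eq0 addrC F2_addvK.
have t_tc : t != t + c by rewrite -F2_addv_eq0 addrA F2_addvv add0r.
split=> [S s SN sep|x xN _].
  have NS : N = S :|: (N :\: S).
    apply/setP => v; rewrite [RHS]in_setU in_setD.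
    by case: (boolP (v \in S)) => [/(subsetP SN)->|].
  have dS : [disjoint S & N :\: S].
    by apply/pred0P => v /=; rewrite in_setD; case: (v \in S).
  have sep' : separates (N :\: S) S s by move=> w wS' wS; apply: sep.
  have inS' l : l \in L -> l \notin S -> l \in N :\: S.
    by move=> lL lS; rewrite in_setD lS in_setU lL orbT.
  have sideS l1 l2 : l1 \in L -> l2 \in L -> l1 != l2 -> l1 \in S -> l2 \in S ->
      (#|S| <= 1)%N \/ (#|N :\: S| <= 1)%N.
    by move=> *; right; apply: (@conn3_triangle_side S _ s l1 l2).
  have sideS' l1 l2 : l1 \in L -> l2 \in L -> l1 != l2 -> l1 \notin S ->
      l2 \notin S -> (#|S| <= 1)%N \/ (#|N :\: S| <= 1)%N.
    move=> *; left; apply: (@conn3_triangle_side (N :\: S) _ s l1 l2) => //;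
      try exact: inS'; by [exact: etrans NS (setUC _ _)|rewrite disjoint_sym].
  have [cS|cS] := boolP (c \in S); have [tS|tS] := boolP (t \in S);
    have [tcS|tcS] := boolP (t + c \in S);
    by [exact: (sideS c t)|exact: (sideS c (t + c))|exact: (sideS t (t + c))|
        exact: (sideS' c t)|exact: (sideS' c (t + c))|exact: (sideS' t (t + c))].
have inN l : l \in L -> l != x -> l \in sp (N :\ x).
  by move=> lL lx; rewrite mem_sp // in_setD1 lx in_setU lL orbT.
have [xL|xL] := boolP (x \in L).
  have [l1 [l2 [l1L l2L l1x l2x eqx]]] :
      exists l1 l2, [/\ l1 \in L, l2 \in L, l1 != x, l2 != x & x = l1 + l2].
    move: xL; rewrite !inE => /orP[/orP[]|] /eqP->.
    - by exists t, (t + c); rewrite tL tcL ![_ == c]eq_sym c_t c_tc; split=> //; vec_ring.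
    - by exists c, (t + c); rewrite cL tcL c_t eq_sym t_tc; split=> //; vec_ring.
    - by exists t, c; rewrite cL tL c_tc t_tc.
  by rewrite [X in X \in _]eqx rpredD ?inN.
have xX : x \in X by move: xN; rewrite in_setU (negPf xL) orbF.
have LN l : l \in L -> l \in sp (N :\ x).
  by move=> lL; apply: inN => //; apply: contraNneq xL => <-.
have xc : x != c by apply: contraNneq xL => ->.
have sX : [set x] \subset X by rewrite sub1set.
have [x' [y [xX' yY xy]]] := sp_decomp sX (no_coloop xX xc).
rewrite [X in X \in _]xy rpredD //; first by apply: mem_spS xX'; rewrite setSD // subsetUl.
have yX : y \in sp X.
  have -> : y = x + x' by rewrite xy; vec_ring.
  by rewrite rpredD ?(mem_sp xX) // (mem_spS _ xX') // subsetDl.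
apply: subvP (capXY yX yY); apply: sp_sub => l lL; apply: LN.
exact: (subsetP ctL).
Qed.

End Triangle.

End Reduction.

(** * Contracting a point on no triangle with [e] in a counterexample of minimum rank *)

Section MinimalCounterexample.

Variable n : nat.
Notation V := 'rV['F_2]_n.
Implicit Types (A B F S X Y Z : {set V}) (U : {vspace V}).
Implicit Types (g l s t u v w x y z : V).

Variables (E : {set V}) (e c : V) (H : {vspace V}).
Hypotheses (thE : thin E e) (conE : conn3 E).
Hypothesis IH : forall F, (\dim (sp F) < \dim (sp E))%N ->
  thin F e -> conn3 F -> forall x, x \in F -> x != e -> x + e \in F.
Hypotheses (cE : c \in E) (ce : c != e) (ceE : c + e \notin E).
Hypotheses (cH : c \notin H) (eH : e \in H).
Hypothesis HV : forall v, v \in H \/ v + c \in H.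

Notation E2 := (contr E c H).
Notation lift := (unfold_class E c).

Let E0 : 0 \notin E. Proof. by case: thE. Qed.
Let eE : e \in E. Proof. by case: thE. Qed.
Let c0 : c != 0. Proof. by apply: contraNneq E0 => <-. Qed.

Lemma mem_contr_e : e \in E2.
Proof. by rewrite inE eH eE andbT /=; apply: contraNneq E0 => <-. Qed.

(* Otherwise the other side of the separation can be contracted onto the line
   [{c, t, t + c}]; this turns [E] into a smaller set that is still [thin] and
   3-connected, but in which [c] is on no triangle with [e]. *)
Lemma contr_2sep_tip S t :
  S \subset E2 -> e \in S -> separates S (E2 :\: S) t ->
  (1 < #|S|)%N -> (1 < #|E2 :\: S|)%N ->
  forall w, w \in sp S -> w \in sp (E2 :\: S) -> w = 0 \/ w = e.
Proof.
move=> SE eS sep S1 S'1 w wS wS'.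
have [->|w0] := eqVneq w 0; first by left.
have [->|we] := eqVneq w e; [by right|exfalso].
have eqwt : w = t by case: (sep w wS wS') => // w_0; rewrite w_0 eqxx in w0.
rewrite {w}eqwt in w0 we wS wS'.
set S' := E2 :\: S in sep S'1 wS'; have S'E : S' \subset E2 by apply: subsetDl.
pose X := lift S; pose Y := lift S'.
have EXY : E = c |: (X :|: Y) by apply: lift_cover.
have dXY : [disjoint X & Y] by apply: lift_disjoint SE.
have cnX : c \notin X by apply: lift_c SE.
have cnY : c \notin Y by apply: lift_c S'E.
have X1 : (1 < #|X|)%N by apply: leq_trans S1 (card_lift cH SE).
have Y1 : (1 < #|Y|)%N by apply: leq_trans S'1 (card_lift cH S'E).
have tH : t \in H by apply: sp_contr_H SE wS.
have tc : t != c by apply: contraNneq cH => <-.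
have e_ct : e \notin sp [set c; t].
  apply/negP => /mem_sp2[] eq_e.
  - by case/negP: E0; rewrite -eq_e.
  - by move: ce; rewrite eq_e eqxx.
  - by rewrite eq_e eqxx in we.
  - by apply: (mem_H_addc cH tH); rewrite -eq_e.
have cap w : w \in sp (c |: X) -> w \in sp (c |: Y) -> w \in sp [set c; t].
  move=> wX wY; have [u [uS uS' wu]] := sp_lift_cap cH SE S'E wX wY.
  have tct : t \in sp [set c; t] by rewrite mem_sp // !inE eqxx orbT.
  have cct : c \in sp [set c; t] by rewrite mem_sp // !inE eqxx.
  case: (sep u uS uS') wu => -> [] ->; rewrite ?add0r ?mem0v //.
  exact: rpredD.
(* Each side spans [c]: otherwise [sp A] would meet the line in at most one nonzero vector, and
   [(A, c |: B)] would be a 2-separation of [E]. *)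
have mem_c (A B : {set V}) : E = c |: (A :|: B) -> [disjoint A & B] ->
    c \notin A ->
    (forall w, w \in sp (c |: A) -> w \in sp (c |: B) -> w \in sp [set c; t]) ->
    (1 < #|A|)%N -> (1 < #|c |: B|)%N -> c \in sp A.
  move=> EAB dAB cA capAB A1 B1; apply: contraT => cspA.
  have dA : [disjoint A & c |: B] by rewrite disjoint_sym disjointsU1 cA disjoint_sym.
  have EA : E = A :|: (c |: B) by rewrite setUCA.
  have noc u v : u \in sp A -> v \in sp A -> u + v = c -> False.
    by move=> uA vA uv; case/negP: cspA; rewrite -uv rpredD.
  have sepA : exists s, separates A (c |: B) s.
    have [tA|tA] := boolP (t \in sp A); [exists t|exists (t + c)];
      move=> w wA wB; (have /mem_sp2[] := capAB w (spUr _ wA) wB) => eqw;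
      try (by [left|right]); exfalso.
    - by rewrite eqw (negPf cspA) in wA.
    - by apply: noc wA tA _; rewrite eqw; vec_ring.
    - by rewrite eqw (negPf cspA) in wA.
    - by rewrite eqw (negPf tA) in wA.
  have [s seps] := sepA.
  by case: (conn3_partition conE EA dA seps); rewrite leqNgt ?A1 ?B1.
have cX : c \in sp X.
  by apply: (mem_c X Y) => //; rewrite cardsU1 cnY add1n ltnS ltnW.
have cY : c \in sp Y.
  apply: (mem_c Y X) => //; rewrite ?cardsU1 ?cnX ?add1n ?ltnS 1?ltnW //.
  - by rewrite [Y :|: X]setUC.
  - by rewrite disjoint_sym.
  by move=> w wY wX; apply: cap.
have spcX w : w \in sp (c |: X) -> w \in sp X.
  apply/subvP/sp_sub => v; rewrite in_setU1 => /orP[/eqP->|/mem_sp] //.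
have spcY w : w \in sp (c |: Y) -> w \in sp Y.
  apply/subvP/sp_sub => v; rewrite in_setU1 => /orP[/eqP->|/mem_sp] //.
have tX : t \in sp X by apply: spcX; apply: sp_sub_lift SE wS.
have tY : t \in sp Y by apply: spcY; apply: sp_sub_lift S'E wS'.
have capXY w : w \in sp X -> w \in sp Y -> w \in sp [set c; t].
  by move=> wX wY; apply: cap; apply: spUr.
(* If [Y] were on the line, then [S'] would be [{t}], as [t] is the only nonzero vector of the line
   in [H]. *)
have Yell : ~ (sp Y <= sp [set c; t])%VS.
  move=> /subvP Yct; move: S'1; rewrite ltnNge => /negP[].
  apply: leq_trans (_ : #|[set t]| <= 1)%N; last by rewrite cards1.
  apply: subset_leq_card; apply/subsetP => s sS'; rewrite inE.
  have sH := contr_H (subsetP S'E s sS').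
  have s_0 : s != 0.
    by apply: contraNneq (contr0 E c H) => <-; apply: (subsetP S'E).
  have /mem_sp2[] : s \in sp [set c; t].
    by apply: Yct; apply: spcY; apply: sp_sub_lift S'E (mem_sp sS').
  - by move=> s00; rewrite s00 eqxx in s_0.
  - by move=> sc; rewrite sc (negPf cH) in sH.
  - by move=> ->.
  by move=> stc; case: (mem_H_addc cH tH); rewrite -stc.
have YE : Y \subset E by apply: lift_sub.
have XE : X \subset E by apply: lift_sub.
have Y0 : 0 \notin Y by apply: contra E0 => /(subsetP YE).
have ctY : (sp [set c; t] <= sp Y)%VS.
  by apply: sp_sub => v; rewrite !inE => /orP[] /eqP->.
(* A part of [Y] attached to the line and the rest of [Y] along at most one nonzero vector is
   attached to all of [E] in this way, so it has at most one point. *)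
have small Y1' s (Y2' : {set V}) : Y1' \subset Y -> Y2' \subset Y ->
    Y \subset Y1' :|: Y2' -> [disjoint Y1' & Y2'] ->
    (forall w x y, w \in sp Y1' -> x \in sp [set c; t] -> y \in sp Y2' ->
       w = x + y -> w = 0 \/ w = s) -> (#|Y1'| <= 1)%N.
  move=> Y1Y Y2Y YY dY sepY.
  have EY : E = Y1' :|: (c |: (X :|: Y2')).
    apply/setP => v; rewrite EXY !in_setU1 !in_setU.
    have : (v \in Y) = (v \in Y1') || (v \in Y2').
      apply/idP/orP => [/(subsetP YY)|[/(subsetP Y1Y)|/(subsetP Y2Y)]//].
      by rewrite in_setU => /orP.
    by move=> ->; rewrite in_set1; case: (v \in Y1'); rewrite /= ?orbT.
  have d1 : [disjoint Y1' & c |: (X :|: Y2')].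
    rewrite disjoint_sym disjointsU1 (contra (subsetP Y1Y c)) //=.
    apply/pred0P => v /=; rewrite in_setU; apply/negP => /andP[/orP[vX|vY2] vY1].
      by have := disjointFr dXY vX; rewrite (subsetP Y1Y).
    by have := disjointFr dY vY1; rewrite vY2.
  have sep1 : separates Y1' (c |: (X :|: Y2')) s.
    move=> w w1; rewrite setUA => /spUP[x [y [/spcX xX yY wxy]]].
    apply: (sepY w x y) => //; apply: capXY => //.
    have -> : x = w + y by rewrite wxy; vec_ring.
    by rewrite rpredD // ?(mem_spS Y1Y w1) ?(mem_spS Y2Y yY).
  case: (conn3_partition conE EY d1 sep1) => // h.
  suff : (1 < #|c |: (X :|: Y2')|)%N by rewrite ltnNge h.
  apply: leq_trans X1 _; apply: subset_leq_card.
  by apply/subsetP => v vX; rewrite in_setU1 in_setU vX orbT.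
(* A split as in [linking] makes both parts small in this sense; then [Y] has at most two points, so
   it spans only the line, contrary to [Yell]. *)
have linkY g Y1' Y2' : g = t \/ g = t + c -> Y1' \subset Y -> Y2' \subset Y ->
    Y \subset Y1' :|: Y2' ->
    ~ (forall w, w \in sp (c |: Y1') -> w \in sp (g |: Y2') -> w = 0).
  move=> gt Y1Y Y2Y YY dir.
  have dY : [disjoint Y1' & Y2'].
    apply/pred0P => v /=; apply/negP => /andP[v1 v2].
    have v0 : v = 0 by apply: dir; rewrite mem_sp // inE ?v1 ?v2 orbT.
    by case/negP: Y0; rewrite -v0 (subsetP Y1Y).
  have xP x : x \in sp [set c; t] -> exists a b,
      [/\ a = 0 \/ a = c, b = 0 \/ b = g & x = a + b].
    move=> /mem_sp2[] ->; case: gt => ->.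
    - by exists 0, 0; split; [left|left|rewrite addr0].
    - by exists 0, 0; split; [left|left|rewrite addr0].
    - by exists c, 0; split; [right|left|rewrite addr0].
    - by exists c, 0; split; [right|left|rewrite addr0].
    - by exists 0, t; split; [left|right|rewrite add0r].
    - by exists c, (t + c); split; [right|right|vec_ring].
    - by exists c, t; split; [right|right|vec_ring].
    - by exists 0, (t + c); split; [left|right|rewrite add0r].
  have memc (A : {set V}) a b : a = 0 \/ a = b -> a \in sp (b |: A).
    by case=> ->; rewrite ?mem0v // mem_sp ?setU11.
  have sepc w x y : w \in sp Y1' -> x \in sp [set c; t] -> y \in sp Y2' ->
      w = x + y -> (w = 0 \/ w = c) /\ (y = 0 \/ y = g).
    move=> w1 /xP[a [b [a01 b01 xab]]] y2 wxy.
    have : w + a = 0.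
      apply: dir; first by apply: rpredD; [exact: spUr|exact: memc].
      have -> : w + a = b + y by rewrite wxy xab; vec_ring.
      by apply: rpredD; [exact: memc|exact: spUr].
    move=> /eqP; rewrite F2_addv_eq0 => /eqP wa.
    have : y = b.
      by apply/eqP; rewrite -F2_addv_eq0; apply/eqP; rewrite -(F2_addvv w)
        {2}wxy wa xab; vec_ring.
    by rewrite wa => ->.
  have s1 : (#|Y1'| <= 1)%N.
    apply: (small Y1' c Y2') => // w x y w1 xct y2 wxy.
    by case: (sepc w x y w1 xct y2 wxy).
  have s2 : (#|Y2'| <= 1)%N.
    apply: (small Y2' g Y1') => //.
    - by rewrite setUC.
    - by rewrite disjoint_sym.
    move=> w x y w2 xct y1 wxy.
    have /(sepc y x w y1 xct w2)[] : y = x + w by rewrite wxy; vec_ring.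
    by [].
  apply: Yell; have /eqP<- // : sp [set c; t] == sp Y.
  rewrite eqEdim ctY dim_sp2 //; apply: leq_trans (dim_sp _) _.
  apply: leq_trans (subset_leq_card YY) _.
  by apply: leq_trans (leq_card_setU _ _) _; apply: (leq_add s1 s2).
have [Z [ZY YZ Zct htZ htcZ]] := linking Y0 c0 w0 tc cY tY linkY.
pose N := X :|: [set c; t; t + c].
have NX : (sp N <= sp X)%VS.
  apply: sp_sub => v; rewrite in_setU => /orP[/mem_sp //|].
  by rewrite !inE => /orP[/orP[]|] /eqP-> //; rewrite rpredD.
have eX : e \in X by rewrite inE eE eS.
have spZY v : v \in sp Z -> v \in sp Y by apply: mem_spS.
have spXZ v : v \in sp X -> v \in sp Z -> v = 0.
  by move=> vX vZ; apply: (Zct v (capXY _ vX (spZY _ vZ)) vZ).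
have ell_N l : l \in sp [set c; t] -> l = 0 \/ l \in N.
  by move=> /mem_sp2[] ->; [left|right|right|right]; rewrite // !inE eqxx ?orbT.
have N0 : 0 \notin N.
  rewrite in_setU negb_or (contra (subsetP XE 0)) //= !inE ![0 == _]eq_sym.
  by rewrite (negPf c0) (negPf w0) F2_addv_eq0 (negPf tc).
have thN : thin N e.
  apply: (thin_minor (Z := Z) thE) => //.
  - by rewrite in_setU eX.
  - apply/subsetP => v vZ; have vY := subsetP ZY v vZ.
    rewrite !inE (subsetP YE) // andbT; apply/eqP => ve.
    by have := disjointFr dXY eX; rewrite -ve vY.
  - have YEhit v : hit Y (sp Z) v -> hit E (sp Z) v.
      by case/hitP => w wY wv; apply/hitP; exists w => //; apply: (subsetP YE).
    move=> v; rewrite in_setU => /orP[/(subsetP XE)/mem_hit //|].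
    rewrite !inE => /orP[/orP[]|] /eqP->.
    + exact: mem_hit.
    + exact: YEhit.
    + exact: YEhit.
  - move=> w wE _; move: (wE); rewrite EXY in_setU1 in_setU => /or3P[/eqP->|wX|wY].
    + by right; apply: mem_hit; rewrite !inE eqxx orbT.
    + by right; apply: mem_hit; rewrite in_setU wX.
    have [l lct wl] := YZ w wY.
    case: (ell_N l lct) => [l0|lN]; first by left; rewrite -[w]addr0 -l0.
    by right; apply/hitP; exists l => //; rewrite addrC.
  - by move=> v /(subvP NX); apply: spXZ.
  move=> w wE we'; apply/negP => weZ.
  move: (wE); rewrite EXY in_setU1 setUC in_setU => /or3P[/eqP wc|wY|wX].
  - case/eqP: we'; apply/eqP; rewrite -F2_addv_eq0; apply/eqP.
    by apply: spXZ => //; rewrite rpredD ?(mem_sp eX) // wc.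
  - case/negP: e_ct; apply: capXY; first exact: mem_sp.
    by rewrite -(memv_addr _ (mem_sp wY)) spZY.
  case/eqP: we'; apply/eqP; rewrite -F2_addv_eq0; apply/eqP.
  by apply: spXZ => //; rewrite rpredD ?mem_sp.
have conN : conn3 N by apply: (conn3_triangle conE E0 EXY dXY).
have XltE : (\dim (sp N) < \dim (sp E))%N.
  apply: leq_ltn_trans (dimvS NX) _; rewrite ltnNge; apply/negP => le.
  have XEs := spS XE; have /eqP eqXE : sp X == sp E by rewrite eqEdim XEs.
  apply: Yell; apply: sp_sub => y yY; apply: capXY; last exact: mem_sp.
  by rewrite eqXE mem_sp // (subsetP YE).
have cN : c \in N by rewrite !inE eqxx orbT.
(* The induction hypothesis puts [c + e] in [N]. As it is not in [E], it is on the line, whose span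
   would then contain [e]. *)
have := IH XltE thN conN cN ce.
rewrite in_setU => /orP[/(subsetP XE)|]; first by rewrite (negPf ceE).
rewrite !inE => /orP[/orP[]|] /eqP eqce; case/negP: e_ct.
- have -> : e = 0 by rewrite -(addr0 e) -(F2_addvv c) addrA [e + c]addrC eqce F2_addvv.
  exact: mem0v.
- have -> : e = c + t by rewrite -eqce; vec_ring.
  by rewrite rpredD // mem_sp // !inE eqxx ?orbT.
have -> : e = t by rewrite -[RHS](F2_addvK _ c) -eqce; vec_ring.
by rewrite mem_sp // !inE eqxx ?orbT.
Qed.


(* A smallest part [F] containing [y] that is attached to the rest only at [e]
   is 3-connected by [contr_2sep_tip], so that the induction hypothesis applies
   to it. *)
Lemma contr_doubled y : y \in E2 -> y != e -> y + e \in E2.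
Proof.
move=> yE2 ye; have eE2 := mem_contr_e.
pose P F := [&& F \subset E2, e \in F, y \in F & [forall w, (w \in sp F) ==>
  ((w \in sp (e |: (E2 :\: F))) ==> ((w == 0) || (w == e)))]].
have PP F : reflect [/\ F \subset E2, e \in F, y \in F & forall w, w \in sp F ->
    w \in sp (e |: (E2 :\: F)) -> w = 0 \/ w = e] (P F).
  apply: (iffP and4P) => -[FE eF yF sepF]; split=> //.
    move=> w wF wF'; have := forallP sepF w; rewrite wF wF' /=.
    by case/orP => /eqP; [left|right].
  apply/forallP => w; apply/implyP => wF; apply/implyP => wF'.
  by case: (sepF w wF wF') => ->; rewrite eqxx ?orbT.
have P0 : P E2.
  apply/PP; split=> // w _; rewrite setDv setU0 sp1.
  exact: memv_line2.
case: (@arg_minnP _ E2 P (fun F => #|F|) P0) => F /PP[FE eF yF sepF] minF.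
suff : y + e \in F by move/(subsetP FE).
have E20 : 0 \notin E2 := contr0 E c H.
have FH v : v \in sp F -> v \in H by apply: sp_contr_H FE.
have cnF : c \notin sp F by apply: contra cH; apply: FH.
have E2E v : v \in E2 -> hit E <[c]> v.
  rewrite inE => /and3P[_ _ /orP[vE|vE]]; apply/hitP; [exists v|exists (v + c)] => //.
    by rewrite F2_addvv mem0v.
  have -> : v + c + v = c by vec_ring.
  exact: memv_line.
have thF : thin F e.
  apply: (thin_minor (Z := [set c]) thE); rewrite ?sp1 //.
  - by apply: contra E20; apply: (subsetP FE).
  - by rewrite sub1set !inE ce cE.
  - by move=> v /(subsetP FE)/E2E.
  - move=> w wE /memv_addline wF; have [->|wc] := eqVneq w c.
      by left; apply: memv_line.
    right; have [v vE vw] := contr_rep HV E0 wE wc.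
    have vwc : v + w \in <[c]>%VS.
      case: vw => ->; first by rewrite F2_addvv mem0v.
      have -> : w + c + w = c by vec_ring.
      exact: memv_line.
    have vH := contr_H vE.
    have vF : v \in sp F.
      move: vH; case: vw wF => -> [] // /FH h1 h2; exfalso.
        exact: (mem_H_addc cH h2 h1).
      exact: (mem_H_addc cH h1 h2).
    apply/hitP; exists v => //; apply: contraT => vnF.
    case: (sepF v vF) => [|v0|ve]; last by rewrite ve eF in vnF.
      by apply: spUr; rewrite mem_sp // in_setD vnF.
    by case/negP: E20; rewrite -v0.
  - by move=> v /FH vH /memv_line2[] // vc; rewrite vc (negPf cH) in vH.
  move=> w wE we; apply/negP => /memv_line2[] /eqP.
    by rewrite F2_addv_eq0 (negPf we).
  by move=> /eqP wec; case/negP: ceE; rewrite -wec F2_addvK.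
have dimF : (\dim (sp F) < \dim (sp E))%N.
  have FsE : (sp F <= sp E)%VS.
    apply: sp_sub => v /(subsetP FE)/E2E/hitP[w wE /memv_line2[/eqP|wv]].
      by rewrite F2_addv_eq0 => /eqP <-; apply: mem_sp.
    have -> : v = w + c by rewrite -wv; vec_ring.
    by rewrite rpredD ?mem_sp.
  rewrite ltnNge; apply: contra cnF => le.
  have /eqP-> : sp F == sp E by rewrite eqEdim FsE.
  exact: mem_sp.
(* A 2-separation of [F] with [e] in [S] extends to one of [E2], all other points joining [S], and
   is therefore at [e]. Whichever of [S] and [e |: S'] contains [y] is then a smaller candidate than
   [F]. *)
have sepD S S' : F = S :|: S' -> [disjoint S & S'] -> e \in S ->
    (1 < #|S|)%N -> (1 < #|S'|)%N -> forall t, separates S S' t -> False.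
  move=> FS dS eS S1 S'1 t sepS.
  have [SF S'F] : S \subset F /\ S' \subset F by rewrite FS subsetUl subsetUr.
  have [SE S'E] := conj (subset_trans SF FE) (subset_trans S'F FE).
  pose S2 := E2 :\: S'.
  have S2E : S2 \subset E2 by apply: subsetDl.
  have E2S2 : E2 :\: S2 = S'.
    by rewrite /S2 setDDr setDv set0U; apply/setIidPr.
  have SS2 : S \subset S2.
    apply/subsetP => v vS; rewrite in_setD (subsetP SE) // andbT.
    by rewrite (disjointFr dS vS).
  have eS2 : e \in S2 by apply: (subsetP SS2).
  have S2P : S2 = S :|: (E2 :\: F).
    apply/setP => v; rewrite in_setU !in_setD FS in_setU negb_or.
    case: (boolP (v \in S)) => [vS|_] /=.
      by rewrite (disjointFr dS vS) (subsetP SE).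
    by [].
  have sp_split w : w \in sp S2 -> exists s f, [/\ s \in sp S, f \in sp (E2 :\: F) &
      w = s + f] by rewrite S2P => /spUP.
  have outF f : f \in sp (E2 :\: F) -> f \in sp F -> f = 0 \/ f = e.
    by move=> fE fF; apply: sepF => //; apply: spUr.
  have spSF w : w \in sp S -> w \in sp F by apply: mem_spS.
  have spS'F w : w \in sp S' -> w \in sp F by apply: mem_spS.
  have e_spS : e \in sp S by apply: mem_sp.
  have sep2 : separates S2 (E2 :\: S2) t.
    rewrite E2S2 => w /sp_split[s [f [sS fE wsf]]] wS'.
    apply: sepS => //; rewrite wsf rpredD //.
    have [|->|->] := outF f fE; rewrite ?mem0v //.
    have -> : f = w + s by rewrite wsf; vec_ring.
    by apply: rpredD; [exact: spS'F|exact: spSF].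
  have tip w : w \in sp S2 -> w \in sp S' -> w = 0 \/ w = e.
    move=> wS2 wS'; apply: (contr_2sep_tip S2E eS2 sep2); rewrite ?E2S2 //.
    by apply: leq_trans S1 _; apply: subset_leq_card.
  have : y \in S :|: S' by rewrite -FS.
  rewrite in_setU => /orP[yS|yS'].
    have /minF : P S; last first.
      rewrite /= FS cardsU disjoint_setI0 // cards0 subn0.
      by rewrite -{2}[#|S|]addn0 leq_add2l leqNgt ltnW.
    apply/PP; split=> // w wS wS'.
    have : w \in sp ((E2 :\: F) :|: (e |: S')).
      apply: mem_spS wS'; apply/subsetP => v; rewrite !in_setU !in_setD FS in_setU.
      by case/orP => [->|/andP[/negPf->] ->];
        rewrite ?orbT //= andbT orbC; case: (v \in S'); rewrite ?orbT.
    case/spUP => f [w' [fE w'S' wfw]].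
    have w'F : w' \in sp F.
      apply: subvP w'S'; apply: sp_sub => v; rewrite in_setU1.
      by case/orP => [/eqP->|/(subsetP S'F)/mem_sp //]; apply: mem_sp.
    have f_e : f \in sp S.
      have [|->|->] := outF f fE; rewrite ?mem0v //.
      have -> : f = w + w' by rewrite wfw; vec_ring.
      by apply: rpredD => //; apply: spSF.
    have w'S : w' \in sp S.
      have -> : w' = w + f by rewrite wfw; vec_ring.
      exact: rpredD.
    have spSS2 u : u \in sp S -> u \in sp S2 by apply: mem_spS.
    have tipe u : u \in sp S -> u \in sp (e |: S') -> u = 0 \/ u = e.
      move=> uS /spU1P[|ueS']; first by apply: tip; apply: spSS2.
      case: (tip (u + e) _ ueS'); first by rewrite spSS2 ?rpredD.
        by move/eqP; rewrite F2_addv_eq0 => /eqP->; right.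
      by move=> uee; left; rewrite -(F2_addvK u e) uee F2_addvv.
    have fE' : f = 0 \/ f = e by apply: outF => //; apply: spSF.
    have [w'0|w'e] := tipe w' w'S w'S'; rewrite wfw ?w'0 ?w'e ?addr0 //.
    by case: fE' => ->; [right; rewrite add0r|left; rewrite F2_addvv].
  have /minF : P (e |: S').
    apply/PP; rewrite setU11 subUset sub1set eE2 S'E in_setU1 yS' orbT; split=> // w.
    have -> : e |: (E2 :\: (e |: S')) = S2.
      apply/setP => v; rewrite in_setU1 !in_setD in_setU1 negb_or.
      have [->|] //= := eqVneq v e; by rewrite (disjointFr dS eS) eE2.
    move=> /spU1P[wS'|weS'] wS2; first exact: tip.
    case: (tip (w + e) _ weS'); first by rewrite rpredD // mem_sp.
      by move/eqP; rewrite F2_addv_eq0 => /eqP->; right.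
    by move=> uee; left; rewrite -(F2_addvK w e) uee F2_addvv.
  rewrite /= cardsU1 (disjointFr dS eS) FS cardsU disjoint_setI0 // cards0 subn0.
  by rewrite leq_add2r leqNgt S1.
have conF : conn3 F.
  split=> [S t SF sep|x xF _].
    have FS : F = S :|: (F :\: S).
      apply/setP => v; rewrite [RHS]in_setU in_setD.
      by case: (boolP (v \in S)) => [/(subsetP SF)->|].
    have dS : [disjoint S & F :\: S].
      by apply/pred0P => v /=; rewrite in_setD; case: (v \in S).
    case: leqP => S1; first by left.
    case: leqP => S'1; first by right.
    have [eS|eS] := boolP (e \in S); first by case: (sepD _ _ FS dS eS S1 S'1 t sep).
    case: (sepD (F :\: S) S _ _ _ S'1 S1 t) => //.
    - by rewrite setUC.
    - by rewrite disjoint_sym.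
    - by rewrite in_setD eS.
    by move=> w wS' wS; apply: sep.
  apply: contraT => xnF.
  have yFx : F :\ x != set0.
    apply/set0Pn; have [->|xe] := eqVneq x e; [exists y|exists e].
      by rewrite !inE ye yF.
    by rewrite !inE eq_sym xe eF.
  (* A coloop [x] of [F] would disconnect [E2]: if it is [e], then [F :\ e] splits off, and
     otherwise [[set x]] does. Both contradict [contr_connected]. *)
  have [xe|xe] := eqVneq x e.
    have := @contr_connected _ E c H cH HV E0 cE (F :\ e) conE.
    case.
    - by rewrite (subset_trans _ FE) // subD1set.
    - move=> w wF wE2; have wF' : w \in sp F by apply: mem_spS wF; apply: subD1set.
      have [|->//|we] := sepF w wF'; last by rewrite we in wF; move: xnF; rewrite xe wF.
      apply: mem_spS wE2; apply/subsetP => v; rewrite !inE.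
      by case: eqP => //= _; case: (v \in F).
    - by move=> F0; rewrite xe F0 eqxx in yFx.
    move=> /setP/(_ e); rewrite in_setD in_set0 eE2 andbT.
    by rewrite in_setD1 eqxx.
  have := @contr_connected _ E c H cH HV E0 cE [set x] conE.
  case.
  - by rewrite sub1set (subsetP FE).
  - move=> w; rewrite sp1 => /memv_line2[//|->] xE2; exfalso.
    have : x \in sp ((E2 :\: F) :|: (F :\ x)).
      apply: mem_spS xE2; apply/subsetP => v; rewrite in_setU !in_setD => /andP[->].
      by move=> ->; rewrite andbT /=; case: (v \in F).
    case/spUP => f [f' [fE f'F xff]].
    have f'F' : f' \in sp F by apply: mem_spS f'F; apply: subD1set.
    have fF : f \in sp F.
      have -> : f = x + f' by rewrite xff; vec_ring.
      by rewrite rpredD // mem_sp.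
    case/negP: xnF; rewrite [X in X \in _]xff rpredD //.
    case: (sepF f fF); first exact: spUr.
      by move=> ->; apply: mem0v.
    by move=> ->; apply: mem_sp; rewrite !inE eq_sym xe eF.
  - by move/setP/(_ x); rewrite !inE eqxx.
  move=> /setP/(_ e); rewrite in_setD in_set0 eE2 andbT in_set1 eq_sym.
  by rewrite xe.
exact: IH dimF thF conF y yF ye.
Qed.

End MinimalCounterexample.

(** * Every point is on a triangle with [e] *)

Section Tip.

Variable n : nat.
Notation V := 'rV['F_2]_n.
Implicit Types (D E F Q R X Y Z : {set V}) (U H : {vspace V}).
Implicit Types (b c e s t u v w x y z : V).

(** The set [C] of the outline: over F_2, the third point on the line through [x] and [e] is
    [x + e]. *)
Definition untipped E e : {set V} := [set x in E | (x != e) && (x + e \notin E)].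

Lemma untippedP E e x :
  reflect [/\ x \in E, x != e & x + e \notin E] (x \in untipped E e).
Proof. by rewrite inE; apply: and3P. Qed.

(* If a point lying on no triangle with [e] were a sum of other points, then a
   shortest such sum [b1 + b2 + r] would yield exactly six points of the plane
   through [e], [b1], [b2] after contraction of the summands of [r]. *)
Lemma untipped_span E e c :
  0 \notin E -> e \in E -> K4_closed E -> c \in untipped E e ->
  c \notin sp (E :\: untipped E e).
Proof.
move=> E0 eE clE; set C := untipped E e => cC.
(* [B] is closed under adding [e], so [e] can be absorbed into any summand from [B]. *)
pose B := (E :\: C) :\ e.
have eC : e \notin C by apply/untippedP => -[_ /eqP].
have eB : E :\: C = e |: B by rewrite setD1K // inE eE eC.
have e_0 : e != 0 by apply: contraNneq E0 => <-.
have BE b : b \in B -> b \in E by case/setD1P=> _ /setDP[].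
have BC b : b \in B -> b \notin C by case/setD1P=> _ /setDP[].
have Be b : b \in B -> e + b \in B.
  move=> bB; case/setD1P: (bB) => be /setDP[bE bC].
  have beE : b + e \in E.
    by apply: contraNT bC => beE; apply/untippedP.
  rewrite addrC in_setD1 in_setD beE andbT; apply/andP; split.
    by apply: contraNneq E0 => h; rewrite -(F2_addvv e) -{1}h F2_addvK.
  by apply/untippedP => -[_ _]; rewrite F2_addvK bE.
apply/negP; rewrite eB => ceB.
have [c0 ce c_e] := untippedP _ _ _ cC.
have cB : c \in sp B.
  have [B0|[b bB]] := set_0Vmem B.
    move: ceB; rewrite B0 setU0 sp1 => /memv_line2[] ceq.
      by move: E0; rewrite -ceq c0.
    by rewrite ceq eqxx in ce.
  have eB' : e \in sp B.
    have -> : e = (e + b) + b by rewrite F2_addvK.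
    by rewrite rpredD // mem_sp // Be.
  by apply: subvP ceB; apply: sp_sub => v; rewrite in_setU1 => /orP[/eqP->|/mem_sp].
have [D0 D0B cD0] := spP cB.
pose P D := (D \subset B) && (\sum_(q in D) q \in C).
have P0 : P D0 by rewrite /P D0B -cD0.
case: (@arg_minnP _ D0 P (fun D => #|D|) P0) => D /andP[DB DC] minD.
have minC (D' : {set V}) : D' \subset B -> \sum_(q in D') q \in C -> (#|D| <= #|D'|)%N.
  by move=> D'B D'C; apply: minD; rewrite /P D'B.
have C0 : 0 \notin C by rewrite inE (negPf E0).
have [D_0|[b1 b1D]] := set_0Vmem D.
  by move: DC; rewrite D_0 big_set0 (negPf C0).
have b1B := subsetP DB _ b1D.
have [D_0|[b2 b2D]] := set_0Vmem (D :\ b1).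
  by move: DC; rewrite (big_setD1 b1) //= D_0 big_set0 addr0 (negPf (BC _ b1B)).
have b2B : b2 \in B by apply: (subsetP DB); case/setD1P: b2D.
pose R := D :\ b1 :\ b2; pose r := \sum_(q in R) q.
have cardD : #|D| = #|R|.+2 by rewrite (cardsD1 b1) b1D (cardsD1 b2) b2D.
have eqD : \sum_(q in D) q = b1 + b2 + r.
  by rewrite (big_setD1 b1) //= (big_setD1 b2) //= addrA.
have RB : R \subset B.
  by apply: subset_trans DB; apply: subset_trans (subD1set _ _) (subD1set _ _).
have rU : r \in sp R by apply: sum_sp.
(* From here on, [c] names the element of [C] with the shortest sum. *)
clear cB cD0 ceB c0 ce c_e cC c.
have [c eqc] : exists c, b1 + b2 + r = c by exists (b1 + b2 + r).
have cC : c \in C by rewrite -eqc -eqD.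
have [cE ce c_e] := untippedP _ _ _ cC.
(* By minimality, modulo [sp R] an element of [C] needs two summands from [B], and with exactly two
   the remaining vector of [sp R] must be [r]. *)
have red0 u : u \in sp R -> u \notin C.
  move=> /spP[R1 R1R ->]; apply/negP => /minC; rewrite (subset_trans R1R) // cardD.
  move=> /(_ isT) le; have := subset_leq_card R1R.
  by move=> /(leq_trans le); rewrite leqNgt ltnW.
have addB b (R1 : {set V}) : b \in B -> R1 \subset B ->
    exists R2 : {set V}, [/\ R2 \subset B, (#|R2| <= #|R1|.+1)%N &
      \sum_(q in R2) q = b + \sum_(q in R1) q].
  move=> bB R1B; have [R2 [R2R cR2 sR2]] := sum_add_elem b R1.
  by exists R2; split=> //; apply: subset_trans R2R _; rewrite subUset sub1set bB.
have red1 b u : b \in B -> u \in sp R -> b + u \notin C.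
  move=> bB /spP[R1 R1R ->]; apply/negP => buC.
  have [R2 [R2B cR2 sR2]] := addB b R1 bB (subset_trans R1R RB).
  have := minC R2 R2B; rewrite sR2 => /(_ buC); rewrite cardD => le.
  have := leq_trans le (leq_trans cR2 (subset_leq_card R1R : (#|R1| < #|R|.+1)%N)).
  by rewrite ltnn.
have red2 b b' u : b \in B -> b' \in B -> u \in sp R -> b + b' + u \in C -> u = r.
  move=> bB b'B /spP[R1 R1R ->] buC.
  have [R2 [R2B cR2 sR2]] := addB b' R1 b'B (subset_trans R1R RB).
  have [R3 [R3B cR3 sR3]] := addB b R2 bB R2B.
  have := minC R3 R3B; rewrite sR3 sR2 addrA => /(_ buC); rewrite cardD => le.
  have := leq_trans le (leq_trans cR3 (cR2 : (#|R2| < #|R1|.+2)%N)); rewrite !ltnS => leR.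
  by have /eqP-> : R1 == R by rewrite eqEcard R1R.
have cr : c + r = b1 + b2 by rewrite -eqc F2_addvK.
(* Each dependency gives [c] an expression excluded by the three preceding facts. In the last case,
   [c + e] is a sum over a subset of [R], and [e] is absorbed into one of its terms. *)
have nU : indep3 (sp R) e b1 b2.
  apply/and5P; split; [| | | |apply/and3P; split]; apply/negP => uU.
  - have : r + e = r.
      apply: (red2 (e + b1) b2); rewrite ?Be ?rpredD //.
      by have -> : e + b1 + b2 + (r + e) = c by rewrite -eqc; vec_ring.
    by move=> /eqP; rewrite -subr_eq0 addrC addrA F2_oppv F2_addvv add0r (negPf e_0).
  - case/negP: (red1 b2 (b1 + r) b2B (rpredD uU rU)).
    by have -> : b2 + (b1 + r) = c by rewrite -eqc; vec_ring.
  - case/negP: (red1 b1 (b2 + r) b1B (rpredD uU rU)).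
    by have -> : b1 + (b2 + r) = c by rewrite -eqc; vec_ring.
  - case/negP: (red1 (e + b2) (e + b1 + r) (Be _ b2B) (rpredD uU rU)).
    by have -> : e + b2 + (e + b1 + r) = c by rewrite -eqc; vec_ring.
  - case/negP: (red1 (e + b1) (e + b2 + r) (Be _ b1B) (rpredD uU rU)).
    by have -> : e + b1 + (e + b2 + r) = c by rewrite -eqc; vec_ring.
  - case/negP: (red0 (b1 + b2 + r) (rpredD uU rU)).
    by rewrite eqc.
  have [R1 R1R s1] := spP (rpredD uU rU).
  have {}s1 : c + e = \sum_(q in R1) q by rewrite -s1 -eqc; vec_ring.
  have [R10|[b bR1]] := set_0Vmem R1.
    move: s1; rewrite R10 big_set0 => /eqP; rewrite F2_addv_eq0.
    by rewrite (negPf ce).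
  have bR := subsetP R1R b bR1; have bB := subsetP RB b bR.
  have ubR : b + (c + e) \in sp R.
    by apply: rpredD; [exact: mem_sp|rewrite s1 sum_sp].
  case/negP: (red1 (e + b) (b + (c + e)) (Be _ bB) ubR).
  by have -> : e + b + (b + (c + e)) = c by vec_ring.
have RE : R \subset E by apply/subsetP => b /(subsetP RB)/BE.
(* The classes of [e + b1] and [e + b2] are hit by [B] and that of [b1 + b2] by [c], so some [w]
   hits the seventh class. In [C], it would be [c + e]; equal to [e], it would put [b1 + b2] in
   [sp R]; in [B], it would shorten the sum for [c]. *)
have [|||w wE wU] := hitP _ _ _ (clE R e b1 b2 RE eE (BE _ b1B) (BE _ b2B) nU _ _ _).
- by apply: mem_hit; apply: BE; apply: Be.
- by apply: mem_hit; apply: BE; apply: Be.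
- apply/hitP; exists c => //; rewrite -eqc.
  by have -> : b1 + b2 + r + (b1 + b2) = r by vec_ring.
have [wC|wC] := boolP (w \in C).
  have h : w + (e + b1 + b2) = r.
    apply: (red2 (e + b1) b2); rewrite ?Be //.
    by have -> : e + b1 + b2 + (w + (e + b1 + b2)) = w by vec_ring.
  case/negP: c_e; rewrite -eqc -h.
  by have -> : b1 + b2 + (w + (e + b1 + b2)) + e = w by vec_ring.
have [we|we] := eqVneq w e.
  case/and5P: nU => _ _ _ _ /and3P[_ /negP h _]; case: h.
  by have -> : b1 + b2 = w + (e + b1 + b2) by rewrite we; vec_ring.
have wB : w \in B by rewrite in_setD1 we in_setD wC.
case/negP: (red1 (e + w) (w + (e + b1 + b2) + r) (Be _ wB) (rpredD wU rU)).
by have -> : e + w + (w + (e + b1 + b2) + r) = c by rewrite -eqc; vec_ring.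
Qed.

Theorem thin_tip E e x : thin E e -> conn3 E -> x \in E -> x != e -> x + e \in E.
Proof.
have [m] := ubnP (\dim (sp E)); elim: m => // m IH in E x *.
rewrite ltnS => ltm thE conE xE xe; apply: contraT => xeE.
have [E0 eE clE clEe] := thE.
pose C := untipped E e.
have xC : x \in C by apply/untippedP.
have e_0 : e != 0 by apply: contraNneq E0 => <-.
have CE c : c \in C -> c \in E by case/untippedP.
have C_0 c : c \in C -> c != 0 by move/CE => cE; apply: contraNneq E0 => <-.
(* This is [contr_doubled] read back in [E], with [y] replaced by its representative modulo [c]. *)
have D1 c y : c \in C -> y \in E -> y != e -> y != c ->
    y + e \in E \/ y + e + c \in E.
  move=> cC yE ye yc; have [cE ce ceE] := untippedP _ _ _ cC.
  have ncl : c \notin <[e]>%VS.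
    apply/negP => /memv_line2[] ceq; first by have := C_0 c cC; rewrite ceq eqxx.
    by rewrite ceq eqxx in ce.
  have [H [eH cH HV]] := memv_hyperplane ncl.
  have {}eH : e \in H by apply: (subvP eH); apply: memv_line.
  have dbl := contr_doubled thE conE _ cE ce ceE cH eH HV.
  have [v vE vy] := contr_rep HV E0 yE yc.
  have ve : v != e.
    apply: contraNneq ceE => ve; case: vy; rewrite ve => ey.
      by rewrite ey eqxx in ye.
    by have -> : c + e = y by rewrite ey; vec_ring.
  have : v + e \in contr E c H.
    by apply: dbl => // F dF thF conF z; apply: IH => //; apply: leq_trans dF ltm.
  rewrite inE => /and3P[_ _ /orP[]]; case: vy => ->; [left|right|right|left] => //.
    by have -> : y + e + c = y + c + e by vec_ring.
  by have -> : y + e = y + c + e + c by vec_ring.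
have D2 c c' : c \in C -> c' \in C -> c != c' -> c + c' + e \in E.
  move=> cC c'C cc'; have [c'E c'e c'eE] := untippedP _ _ _ c'C.
  have [cE ce ceE] := untippedP _ _ _ cC.
  case: (D1 c c' cC c'E c'e); rewrite 1?eq_sym //; first by rewrite (negPf c'eE).
  by have -> : c' + e + c = c + c' + e by vec_ring.
(* Otherwise [c1], [c2] and [c1 + c2 + e] are independent modulo [c3], their pairwise sums are hit
   by [E :\ e], and their total is [e]. Then [E :\ e] would have a point in [{e, e + c3}], which it
   has not. *)
have three c1 c2 c3 : c1 \in C -> c2 \in C -> c3 \in C ->
    c1 != c2 -> c1 != c3 -> c2 != c3 -> c1 + c2 + c3 = e.
  move=> c1C c2C c3C c12 c13 c23; apply/eqP; apply: contraT => ne.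
  have [c1E c1e c1eE] := untippedP _ _ _ c1C.
  have [c2E c2e c2eE] := untippedP _ _ _ c2C.
  have [c3E c3e c3eE] := untippedP _ _ _ c3C.
  have sumE := D2 _ _ c1C c2C c12.
  have sum_ne : c1 + c2 + e != e.
    apply: contraNneq c12 => h; rewrite -F2_addv_eq0.
    by rewrite -(F2_addvK (c1 + c2) e) h F2_addvv.
  have in1 c : c \in E -> c != e -> c \in E :\ e by rewrite !inE => -> ->.
  have ne3 u : u != 0 -> u != c3 -> u \notin sp [set c3].
    move=> u0 u3; rewrite sp1; apply/negP => /memv_line2[] /eqP.
      by rewrite (negPf u0).
    by rewrite (negPf u3).
  have E_ne_c c u : c + e \notin E -> u \in E -> c + e != u.
    by move=> h uE; apply: contraNneq h => ->.
  have sum3 : c1 + c2 + e != c3.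
    apply: contraNneq ne => h; rewrite -h.
    by apply/eqP; vec_ring.
  have ab3 : c1 + c2 != c3.
    apply: contraNneq c3eE => h; by rewrite -h.
  have abE : hit (E :\ e) (sp [set c3]) (c1 + c2).
    case: (D1 c3 (c1 + c2 + e) c3C sumE sum_ne sum3) => [|h].
      rewrite F2_addvK => h; apply: mem_hit; apply: in1 => //.
      by apply: contraNneq c1eE => <-; rewrite addrA F2_addvv add0r.
    rewrite F2_addvK in h.
    apply/hitP; exists (c1 + c2 + c3); first exact: in1.
    have -> : c1 + c2 + c3 + (c1 + c2) = c3 by vec_ring.
    by rewrite mem_sp // inE.
  have hit_e c : c \in C -> c != c3 -> hit (E :\ e) (sp [set c3]) (c + e).
    move=> cC cc3; apply/hitP; exists (c + c3 + e).
      apply: in1; first exact: D2.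
      apply: contraNneq cc3 => h; rewrite -F2_addv_eq0.
      by rewrite -(F2_addvK (c + c3) e) h F2_addvv.
    have -> : c + c3 + e + (c + e) = c3 by vec_ring.
    by rewrite mem_sp // inE.
  have e1 : c1 + (c1 + c2 + e) = c2 + e by vec_ring.
  have e2 : c2 + (c1 + c2 + e) = c1 + e by vec_ring.
  have e3 : c1 + c2 + (c1 + c2 + e) = e by vec_ring.
  have h := clEe [set c3] c1 c2 (c1 + c2 + e); rewrite e1 e2 e3 in h.
  have : hit (E :\ e) (sp [set c3]) e.
    apply: h; rewrite ?sub1set ?in1 ?hit_e //.
    have ceP c : c \in C -> c + e \notin sp [set c3].
      case/untippedP => _ ce ceE; apply: ne3; first by rewrite F2_addv_eq0.
      exact: E_ne_c.
    have s0 : c1 + c2 + e != 0 by apply: contraNneq E0 => <-.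
    apply/and5P; rewrite e1 e2 e3; split; [| | | |apply/and3P; split].
    - by apply: ne3 => //; apply: C_0.
    - by apply: ne3 => //; apply: C_0.
    - exact: ne3.
    - by apply: ne3 => //; rewrite F2_addv_eq0.
    - exact: ceP.
    - exact: ceP.
    by apply: ne3 => //; rewrite eq_sym.
  move=> /hitP[w]; rewrite !inE sp1 => /andP[we wE] /memv_line2[] /eqP.
    by rewrite F2_addv_eq0 (negPf we).
  by move=> /eqP wec; case/negP: c3eE; rewrite -wec F2_addvK.
have nspan c : c \in C -> c \notin sp (E :\: C) by apply: untipped_span.
have eC : e \notin C by apply/untippedP => -[_ /eqP].
have eEC : e \in E :\: C by rewrite in_setD eC.
have CsE : C \subset E by apply/subsetP.
have EEC : E = C :|: (E :\: C).
  apply/setP => v; rewrite [RHS]in_setU in_setD.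
  by case: (boolP (v \in C)) => [/CE->|].
have dC : [disjoint C & E :\: C].
  by apply/pred0P => v /=; rewrite in_setD; case: (v \in C).
have Eonly : (#|E :\: C| <= 1)%N -> E :\: C = [set e].
  by move=> h; apply/esym/eqP; rewrite eqEcard sub1set eEC cards1.
(* [C] has one, two or three points. A single point would be a coloop. *)
have [C1|[c2]] := set_0Vmem (C :\ x).
  have C1' : C = [set x] by rewrite -(setD1K xC) C1 setU0.
  case/negP: (nspan x xC); rewrite C1'; case: conE => _; apply=> //.
  by apply/eqP => Ex; move: eE; rewrite Ex inE eq_sym (negPf xe).
case/setD1P => c2x c2C; have [c2E c2e c2eE] := untippedP _ _ _ c2C.
have C_gt1 : (1 < #|C|)%N.
  apply: leq_trans (_ : #|[set x; c2]| <= _)%N; first by rewrite cards2 eq_sym c2x.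
  by apply: subset_leq_card; rewrite subUset !sub1set xC.
have [C2|[c3]] := set_0Vmem (C :\ x :\ c2).
  have C2' : C = [set x; c2].
    apply/eqP; rewrite eqEsubset subUset !sub1set xC c2C !andbT.
    apply/subsetP => c cC; rewrite in_set2; apply: contraT.
    rewrite negb_or => /andP[cx cc2]; have : c \in C :\ x :\ c2.
      by rewrite !in_setD1 cx cc2.
    by rewrite C2 inE.
  have sepC : separates C (E :\: C) (c2 + x).
    rewrite {1}C2' => w /mem_sp2[] ->; [by move=> _; left| | |by move=> _; right].
      by rewrite (negPf (nspan x xC)).
    by rewrite (negPf (nspan c2 c2C)).
  case: (conn3_partition conE EEC dC sepC); first by rewrite leqNgt C_gt1.
  (* Only [e] is outside [C]. Not being a coloop, it equals [c2 + x], which makes [x + e] the point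
     [c2]. *)
  move=> /Eonly EC; have Ee : E :\ e = [set x; c2].
    rewrite EEC EC setUC setDUl setDv set0U -C2'.
    by apply/setDidPl; rewrite disjoint_sym disjoints1.
  have : e \in sp (E :\ e).
    by case: conE => _; apply=> //; apply/eqP => Ex; move: xE; rewrite Ex inE (negPf xe).
  rewrite Ee => /mem_sp2[] eqe.
  - by rewrite eqe eqxx in e_0.
  - by rewrite eqe eqxx in xe.
  - by rewrite eqe eqxx in c2e.
  case/negP: xeE; have -> : x + e = c2 by rewrite eqe; vec_ring.
  exact: c2E.
case/setD1P => c32 /setD1P[c3x c3C]; have [c3E c3e c3eE] := untippedP _ _ _ c3C.
have eqc3 c : c \in C -> c != x -> c != c2 -> c = x + c2 + e.
  move=> cC cx cc2; rewrite -(three x c2 c) // 1?eq_sym //.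
  by vec_ring.
have C3 : C = [set x; c2; c3].
  apply/setP => c; rewrite in_setU in_set2 in_set1; apply/idP/idP => [cC|].
    have [->|cx] //= := eqVneq c x; have [->|cc2] //= := eqVneq c c2.
    by rewrite (eqc3 c cC cx cc2) -(eqc3 c3 c3C c3x c32) eqxx.
  by case/orP => [/orP[]|] /eqP->.
have c3P := eqc3 c3 c3C c3x c32.
(* As [c3 = x + c2 + e], the vectors [e], [x], [c2] span [C]. None of [x], [c2] and
   [c2 + x = c3 + e] is in the span of [E :\: C], so the spans share at most [e]. *)
have sepC : separates C (E :\: C) e.
  move=> w wC wB; have eB : e \in sp (E :\: C) by apply: mem_sp.
  have : w \in sp (e |: [set x; c2]).
    apply: subvP wC; apply: sp_sub => v; rewrite C3 !inE => h.
    have eS : e \in sp (e |: [set x; c2]) by rewrite mem_sp ?setU11.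
    have xS : x \in sp (e |: [set x; c2]) by rewrite mem_sp // !inE eqxx orbT.
    have c2S : c2 \in sp (e |: [set x; c2]) by rewrite mem_sp // !inE eqxx !orbT.
    by case/orP: h => [/orP[]|] /eqP-> //; rewrite c3P !rpredD.
  have nol u : u \in sp [set x; c2] -> u \in sp (E :\: C) -> u = 0.
    move=> /mem_sp2[] -> //; first by rewrite (negPf (nspan x xC)).
      by rewrite (negPf (nspan c2 c2C)).
    have -> : c2 + x = c3 + e by rewrite c3P; vec_ring.
    by rewrite memv_addl // (negPf (nspan c3 c3C)).
  case/spU1P => h; first by left; apply: nol.
  right; apply/eqP; rewrite -F2_addv_eq0; apply/eqP; apply: nol => //.
  by rewrite rpredD.
case: (conn3_partition conE EEC dC sepC); first by rewrite leqNgt C_gt1.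
move=> /Eonly EC.
(* What remains is the circuit [{e, x, c2, c3}], which is separated into two pairs. *)
have EE : E = [set e; x] :|: [set c2; c3].
  by rewrite EEC EC C3; apply/setP => v; rewrite !inE; do !case: (_ == _).
have dE : [disjoint [set e; x] & [set c2; c3]].
  rewrite disjointsU1 disjoints1 !inE !negb_or ![e == _]eq_sym c2e c3e.
  by rewrite ![x == _]eq_sym c2x c3x.
have sepE : separates [set e; x] [set c2; c3] (x + e).
  move=> w /mem_sp2[] ->; [by move=> _; left| | |by move=> _; right]
    => /mem_sp2[] eqe; exfalso.
  - by rewrite eqe eqxx in e_0.
  - by rewrite eqe eqxx in c2e.
  - by rewrite eqe eqxx in c3e.
  - case/negP: c2eE; have -> : c2 + e = c3 by rewrite eqe; vec_ring.
    exact: c3E.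
  - by have := C_0 x xC; rewrite eqe eqxx.
  - by rewrite eqe eqxx in c2x.
  - by rewrite eqe eqxx in c3x.
  have : e = 0; last by apply/eqP.
  have -> : e = x + c2 + c3 by rewrite c3P; vec_ring.
  by rewrite -addrA [c2 + c3]addrC -eqe F2_addvv.
by case: (conn3_partition conE EE dE sepE); rewrite cards2 ?(eq_sym e) ?xe // eq_sym c32.
Qed.

End Tip.

(** * From matroids to sets of vectors *)

Section Representation.

Variables (T : finType) (n : nat).
Notation V := 'rV['F_2]_n.
Implicit Types (M N : matroid T) (A B F I Q S X Y : {set T}) (x y : T).
Implicit Types (v w : T -> V).

Definition represents v N : Prop :=
  forall X, X \subset ground N -> (X \in indep N) = free [seq v x | x in X].

Lemma span_image v X : <<[seq v x | x in X]>>%VS = sp (v @: X).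
Proof.
apply: eq_span => u; rewrite mem_enum; apply/imageP/imsetP.
  by case=> x xX ->; exists x.
by case=> x xX ->; exists x.
Qed.

Lemma free_dim v X :
  free [seq v x | x in X] = (\dim (sp (v @: X)) == #|X|).
Proof. by rewrite /free span_image size_image. Qed.

Lemma free_setU1 v x X : x \notin X ->
  free [seq v y | y in x |: X] =
  (v x \notin sp (v @: X)) && free [seq v y | y in X].
Proof.
move=> xX; rewrite -span_image -free_cons; apply: perm_free.
apply: (perm_map v (t := x :: enum X)); apply: uniq_perm.
- exact: enum_uniq.
- by rewrite /= mem_enum xX enum_uniq.
by move=> y; rewrite mem_enum !inE mem_enum.
Qed.

Lemma sp_imageP v X u :
  u \in sp (v @: X) -> exists2 Q : {set T}, Q \subset X & u = \sum_(x in Q) v x.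
Proof.
have [m] := ubnP #|X|; elim: m => // m IH in X u *.
case: (set_0Vmem X) => [-> _|[x xX]].
  rewrite imset0 memv_sp0 => /eqP->; exists set0; first exact: sub0set.
  by rewrite big_set0.
rewrite (cardsD1 x) xX => ltm; rewrite -(setD1K xX) imsetU1 => /spU1P[] uX.
  have [Q QX ->] := IH _ _ ltm uX.
  by exists Q => //; rewrite subsetU // QX orbT.
have [Q QX equ] := IH _ _ ltm uX; exists (x |: Q); first by rewrite setUS.
rewrite big_setU1 /=; last first.
  by apply/negP => xQ; have:= subsetP QX _ xQ; rewrite !inE eqxx.
by rewrite -equ addrC F2_addvK.
Qed.

(** Coefficients over F_2 are 0 or 1, so linear combinations are sums over subsets. *)
Lemma free_sum_neq0 v X :
  free [seq v x | x in X] <->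
  forall Q : {set T}, Q \subset X -> Q != set0 -> \sum_(x in Q) v x != 0.
Proof.
have [m] := ubnP #|X|; elim: m => // m IH in X *.
case: (set_0Vmem X) => [-> _|[x xX]].
  split=> [_ Q|_]; first by rewrite subset0 => ->.
  by rewrite free_dim imset0 sp0 dimv0 cards0.
rewrite (cardsD1 x) xX => ltm; rewrite -(setD1K xX); set X' := X :\ x in ltm *.
have xX' : x \notin X' by rewrite !inE eqxx.
rewrite free_setU1 //; split=> [/andP[xsp /(IH _ ltm) frX'] Q QX Q0|h].
  have [xQ|xQ] := boolP (x \in Q).
    rewrite (big_setD1 x) //= F2_addv_eq0; apply: contraNneq xsp => ->.
    apply: rpred_sum => y; rewrite !inE => /andP[yx yQ].
    apply: mem_sp; apply: imset_f; have := subsetP QX y yQ.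
    by rewrite in_setU1 (negPf yx).
  apply: frX' => //; apply/subsetP => y yQ; have := subsetP QX y yQ.
  by rewrite in_setU1 => /orP[/eqP yx|//]; rewrite -yx yQ in xQ.
apply/andP; split; last first.
  by apply/(IH _ ltm) => Q QX; apply: h; rewrite subsetU // QX orbT.
apply/negP => /sp_imageP[Q QX vx].
have xQ : x \notin Q by apply: contra xX'; apply: (subsetP QX).
have /eqP[] : \sum_(y in x |: Q) v y != 0.
  apply: h; first by rewrite setUS.
  by apply/set0Pn; exists x; rewrite setU11.
by rewrite big_setU1 //= vx F2_addvv.
Qed.

Lemma rank_dim v N A : represents v N -> A \subset ground N ->
  rank N A = \dim (sp (v @: A)).
Proof.
move=> rN AN; rewrite -card_basis; set B := basis N A.
have BA : B \subset A by apply: basis_subset.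
have BN := subset_trans BA AN.
have frB : free [seq v x | x in B] by rewrite -rN ?basis_indep.
have -> : sp (v @: A) = sp (v @: B).
  apply/eqP; rewrite eqEsubv; apply/andP; split; last by rewrite spS // imsetS.
  apply: sp_sub => _ /imsetP[a aA ->]; apply: contraT => aB.
  have anB : a \notin B by apply: contra aB => /(imset_f v)/mem_sp.
  have aBA : a |: B \subset A by rewrite subUset sub1set aA.
  have : (#|a |: B| <= rank N A)%N.
    by apply: indep_rank; rewrite ?rN ?free_setU1 ?aB // (subset_trans aBA).
  by rewrite cardsU1 anB -card_basis ltnn.
by apply/esym/eqP; rewrite -free_dim.
Qed.

Lemma represents_restrict v N A : represents v N -> represents v (restrict N A).
Proof.
move=> rN X; rewrite /= subsetI => /andP[XN XA].
by rewrite inE XA andbT; apply: rN.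
Qed.

(** The identity minus the projection onto [U]: an endomorphism with this kernel serves as the
    quotient by [U] and keeps the type of vectors. *)
Lemma lker_exists (U : {vspace V}) : exists f : 'End(V), lker f = U.
Proof.
exists (\1 - projv U)%VF; apply/vspaceP => u.
rewrite memv_ker add_lfunE opp_lfunE id_lfunE subr_eq0.
by apply/eqP/idP => [->|/projv_id->]; rewrite ?memv_proj.
Qed.

(** By rank-nullity, the image under [f] of the span of [I :|: X] has dimension
    [rank N (I :|: X) - rank N X], which is the rank of [I] in the contraction. *)
Lemma represents_contract v N X (f : 'End(V)) :
  represents v N -> X \subset ground N -> lker f = sp (v @: X) ->
  represents (f \o v) (contract N X).
Proof.
move=> rN XN kerf I IX; have IN : I \subset ground N.
  exact: subset_trans IX (subsetDl _ _).
have IXN : I :|: X \subset ground N by rewrite subUset IN.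
have imI : (f @: sp (v @: (I :|: X)))%VS = sp ((f \o v) @: I).
  rewrite imsetU spU limgD.
  have -> : (f @: sp (v @: X) = 0)%VS.
    by apply/eqP; rewrite -lkerE kerf.
  rewrite addv0 -!span_image limg_span; congr span.
  by rewrite -map_comp.
have := limg_ker_dim f (sp (v @: (I :|: X))).
have -> : (sp (v @: (I :|: X)) :&: lker f)%VS = sp (v @: X).
  by rewrite kerf; apply/capv_idPr; rewrite spS // imsetS // subsetUr.
rewrite imI contract_indepE IX /= !(rank_dim rN) // free_dim => <-.
by rewrite addnC eqn_add2r.
Qed.

Lemma indep_set1 v N x : represents v N -> x \in ground N ->
  ([set x] \in indep N) = (v x != 0).
Proof.
move=> rN xN; rewrite rN ?sub1set // -(setU0 [set x]) free_setU1 ?inE //.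
by rewrite imset0 memv_sp0 free_dim imset0 sp0 dimv0 cards0 eqxx andbT.
Qed.

Lemma indep_set2 v N x y : represents v N -> x \in ground N -> y \in ground N ->
  x != y -> ([set x; y] \in indep N) = [&& v x != 0, v y != 0 & v x != v y].
Proof.
move=> rN xN yN xy; rewrite rN ?subUset ?sub1set ?xN // free_setU1 ?inE //.
rewrite imset_set1 sp1 -rN ?sub1set // (indep_set1 rN) //.
apply/andP/and3P => [[xl y0]|[x0 y0 vxy]]; split=> //.
- by apply: contraNneq xl => ->; apply: mem0v.
- by apply: contraNneq xl => ->; apply: memv_line.
by apply/negP => /memv_line2[] /eqP; [rewrite (negPf x0)|rewrite (negPf vxy)].
Qed.

Lemma circuit_set1 v N x : represents v N ->
  circuit N [set x] = (x \in ground N) && (v x == 0).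
Proof.
move=> rN; have [xN|xN] := boolP (x \in ground N); last first.
  apply/negbTE/negP => /minsetP[/andP[xN' _] _].
  by rewrite sub1set (negPf xN) in xN'.
have ind := indep_set1 rN xN.
apply/minsetP/idP => [[/andP[_]]|x0]; first by rewrite ind negbK.
split=> [|B /andP[_ dB] Bx]; first by rewrite /= sub1set xN ind negbK.
apply/eqP; rewrite eqEsubset Bx sub1set; apply: contraNT dB => xB.
suff -> : B = set0 by apply: indep_set0.
apply/eqP; rewrite -subset0; apply/subsetP => y yB.
by have := subsetP Bx y yB; rewrite !inE => /eqP yx; rewrite -yx yB in xB.
Qed.

Lemma parallelE v N x y : represents v N -> x \in nonloops N -> y \in ground N ->
  parallel N x y = (v x == v y).
Proof.
move=> rN; rewrite inE /loop (circuit_set1 _ rN) => /andP[xN]; rewrite xN /= => x0 yN.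
rewrite /parallel; have [->|xy] /= := eqVneq x y; first by rewrite eqxx.
have ind := indep_set2 rN xN yN xy.
apply/minsetP/eqP => [[/andP[_ d] minxy]|vxy].
  have y0 : v y != 0.
    apply/negP => /eqP y0; have /setP/(_ x) : [set y] = [set x; y].
      apply: minxy; last exact: subsetUr.
      by rewrite /= sub1set yN (indep_set1 rN yN) y0 eqxx.
    by rewrite !inE eqxx (negPf xy).
  by apply/eqP; apply: contraR d => vxy; rewrite ind x0 y0.
split=> [|B /andP[_ dB] Bxy].
  by rewrite /= subUset !sub1set xN yN ind vxy eqxx !andbF.
apply/eqP; rewrite eqEsubset Bxy subUset !sub1set /=.
have y0 : v y != 0 by rewrite -vxy.
apply/andP; split; apply: contraNT dB => zB.
  apply: indep_subset (_ : [set y] \in _); last by rewrite (indep_set1 rN yN).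
  apply/subsetP => z zB'; have := subsetP Bxy z zB'; rewrite !inE.
  by case/orP => // /eqP zx; rewrite -zx zB' in zB.
apply: indep_subset (_ : [set x] \in _); last by rewrite (indep_set1 rN xN).
apply/subsetP => z zB'; have := subsetP Bxy z zB'; rewrite !inE.
by case/orP => // /eqP zx; rewrite -zx zB' in zB.
Qed.

(** Over F_2, parallel elements are those with equal nonzero vectors; [pick] fixes one element in
    each class. *)
Definition class_reps v N : {set T} :=
  [set x in ground N | (v x != 0) &&
    ([pick y in ground N | v y == v x] == Some x)].

Lemma class_rep_exists v N x : x \in ground N ->
  exists y, [/\ [pick y in ground N | v y == v x] = Some y,
    y \in ground N & v y = v x].
Proof.
move=> xG; case: pickP => [y /andP[yG /eqP yx]|/(_ x)]; first by exists y.
by rewrite xG eqxx.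
Qed.

Lemma class_reps_simplification v N : represents v N ->
  simplification_set N (class_reps v N).
Proof.
move=> rN; split.
  apply/subsetP => x; rewrite !inE /loop (circuit_set1 _ rN).
  by case/and3P => -> -> _.
move=> x xN; move: (xN); rewrite inE /loop (circuit_set1 _ rN) => /andP[xG].
rewrite xG /= => x0.
have [y [ey yG yx]] := class_rep_exists v xG.
exists y; split=> [|z [zS]].
  rewrite (parallelE rN) // yx eqxx inE yG yx x0 /=; split=> //.
  by apply/eqP; rewrite -[RHS]ey; apply: eq_pick.
move: zS; rewrite inE => /and3P[zG z0 /eqP ez]; rewrite (parallelE rN) // => /eqP xz.
have : Some y = Some z by rewrite -ey -ez; apply: eq_pick => u; rewrite xz.
by case.
Qed.

Lemma class_reps_inj v N : {in class_reps v N &, injective v}.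
Proof.
move=> x y; rewrite !inE => /and3P[_ _ /eqP ex] /and3P[_ _ /eqP ey] vxy.
have : Some x = Some y by rewrite -ex -ey; apply: eq_pick => u; rewrite vxy.
by case.
Qed.

Lemma class_reps_image v N x : x \in ground N -> v x != 0 ->
  exists2 y, y \in class_reps v N & v y = v x.
Proof.
move=> xG x0.
have [y [ey yG yx]] := class_rep_exists v xG.
exists y => //; rewrite inE yG yx x0 /=.
by apply/eqP; rewrite -[RHS]ey; apply: eq_pick.
Qed.

Lemma flat_preimage v N (W : {vspace V}) : represents v N ->
  flat N [set x in ground N | v x \in W].
Proof.
move=> rN; set F := [set x in _ | _].
have FN : F \subset ground N by apply/subsetP => x; rewrite inE => /andP[].
rewrite /flat eqEsubset; apply/andP; split; apply/subsetP => x.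
  rewrite inE => /andP[xN]; have xFN : x |: F \subset ground N.
    by rewrite subUset sub1set xN.
  rewrite !(rank_dim rN) // imsetU1 => /eqP dimF.
  have FW : (sp (v @: F) <= W)%VS.
    by apply: sp_sub => _ /imsetP[y + ->]; rewrite inE => /andP[].
  rewrite inE xN /=; apply: (subvP FW).
  have /eqP-> : sp (v @: F) == sp (v x |: v @: F).
    by rewrite eqEdim dimF leqnn andbT spS // subsetUr.
  by rewrite mem_sp // setU11.
move=> xF; rewrite inE (subsetP FN) //=; apply/eqP; congr rank.
by apply/setUidPr; rewrite sub1set.
Qed.

End Representation.

(** * The cycle matroid of K_4 in coordinates over F_2 *)

Section CompleteGraph.

Variables (n : nat) (a b c : 'rV['F_2]_n).
Hypothesis abc : indep3 0%VS a b c.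
Implicit Types (A D : {set 'I_4}) (Y Q : {set {set 'I_4}}) (i j k l : 'I_4).

(* The vertex [3] is the origin, so that the six edges become [a], [b], [c],
   [a + b], [a + c] and [b + c]. *)
Definition vertex_vec i : 'rV['F_2]_n := nth 0 [:: a; b; c] i.
Definition edge_vec A := \sum_(i in A) vertex_vec i.

Notation p := vertex_vec.
Notation phi := edge_vec.

Let i0 : 'I_4 := @Ordinal 4 0 isT.
Let i1 : 'I_4 := @Ordinal 4 1 isT.
Let i2 : 'I_4 := @Ordinal 4 2 isT.
Let i3 : 'I_4 := @Ordinal 4 3 isT.

Let ord4 i : [\/ i = i0, i = i1, i = i2 | i = i3].
Proof.
case: i => [[|[|[|[|k]]]] // Hi]; by [constructor 1; apply: val_inj|
  constructor 2; apply: val_inj|constructor 3; apply: val_inj|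
  constructor 4; apply: val_inj].
Qed.

Let sum4 (R : nmodType) (F : 'I_4 -> R) :
  \sum_i F i = F i0 + (F i1 + (F i2 + F i3)).
Proof.
rewrite !big_ord_recl big_ord0 addr0.
by congr (F _ + (F _ + (F _ + F _))); apply: val_inj.
Qed.

(** The vertex 3 is sent to 0 and the others to independent vectors, so a vanishing sum can involve
    only the vertex 3. *)
Lemma sum_vertex_eq0 D : \sum_(i in D) p i = 0 ->
  forall i, i != i3 -> i \notin D.
Proof.
rewrite big_mkcond sum4 /vertex_vec /= if_same !addr0.
case/and5P: abc; rewrite !memv0 => a_ b_ c_ ab_ /and3P[ac_ bc_ abc_].
rewrite addrA in abc_ *.
case h0: (i0 \in D); case h1: (i1 \in D); case h2: (i2 \in D);
  rewrite ?add0r ?addr0 => /eqP h;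
  try (by rewrite ?(negPf a_) ?(negPf b_) ?(negPf c_) ?(negPf ab_) ?(negPf ac_)
     ?(negPf bc_) ?(negPf abc_) in h).
by move=> i; case: (ord4 i) => ->; rewrite ?h0 ?h1 ?h2 ?eqxx.
Qed.

(** The symmetric difference of [A] and [B] has sum 0, so they agree except perhaps at the vertex 3,
    where equal cardinality decides. *)
Lemma edge_vec_inj (A B : {set 'I_4}) : #|A| = #|B| -> phi A = phi B -> A = B.
Proof.
move=> cAB AB; pose D := [set i | (i \in A) (+) (i \in B)].
have D0 : \sum_(i in D) p i = 0.
  have -> : \sum_(i in D) p i = phi A + phi B.
    rewrite /edge_vec [LHS]big_mkcond [X in _ = X + _]big_mkcond.
    rewrite [X in _ = _ + X]big_mkcond -big_split /=; apply: eq_bigr => i _.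
    rewrite inE; case: (i \in A); case: (i \in B);
      by rewrite ?F2_addvv ?addr0 ?add0r.
  by rewrite AB F2_addvv.
have eqi i : i != i3 -> (i \in A) = (i \in B).
  by move/(sum_vertex_eq0 D0); rewrite inE; case: (i \in A); case: (i \in B).
have e3 : A :\ i3 = B :\ i3.
  by apply/setP => i; rewrite !in_setD1; case: eqVneq => //= /eqi.
apply/setP => i; have [->|/eqi //] := eqVneq i i3.
move: cAB; rewrite (cardsD1 i3) [RHS](cardsD1 i3) e3.
by case: (i3 \in A); case: (i3 \in B) => // /eqP; rewrite eqn_add2r.
Qed.

Lemma edge_vec2 i j : i != j -> phi [set i; j] = p i + p j.
Proof. by move=> ij; rewrite /edge_vec big_setU1 ?inE //= big_set1. Qed.

Let deg Y i := #|[set A in Y | i \in A]|.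

(** Exchanging the sums shows that the vertices of odd degree sum to 0, so only the vertex 3 can be
    odd; the handshake identity excludes a single odd vertex. *)
Lemma even_degrees Y : (forall A : {set 'I_4}, A \in Y -> #|A| = 2) ->
  \sum_(A in Y) phi A = 0 -> forall i, ~~ odd (deg Y i).
Proof.
move=> Y2 sumY; pose D := [set i | odd (deg Y i)].
have mulF2 (x : 'rV['F_2]_n) d : x *+ d = if odd d then x else 0.
  elim: d => [|d IHd]; first by rewrite mulr0n.
  by rewrite mulrS IHd /=; case: (odd d); rewrite ?F2_addvv ?addr0.
have D0 : \sum_(i in D) p i = 0.
  have <- : \sum_(A in Y) phi A = \sum_(i in D) p i.
    rewrite /edge_vec (exchange_big_dep xpredT) //= [RHS]big_mkcond /=.
    apply: eq_bigr => i _; rewrite inE -mulF2 -sumr_const.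
    by apply: eq_bigl => A; rewrite inE.
  exact: sumY.
have ev i : i != i3 -> ~~ odd (deg Y i).
  by move/(sum_vertex_eq0 D0); rewrite inE.
have hand : (\sum_i deg Y i = 2 * #|Y|)%N.
  rewrite mulnC -sum_nat_const (eq_bigr (fun A : {set 'I_4} => #|A|)); last first.
    by move=> A /Y2.
  under eq_bigr => i _ do rewrite /deg -sum1_card.
  under [RHS]eq_bigr => A _ do rewrite -sum1_card.
  rewrite [RHS](exchange_big_dep xpredT) //=.
  by apply: eq_bigr => i _; apply: eq_bigl => A; rewrite inE.
move=> i; have [->|/ev //] := eqVneq i i3.
have := congr1 odd hand; rewrite oddM /= (@sum4 nat (deg Y)) !oddD.
by rewrite (negPf (ev i0 isT)) (negPf (ev i1 isT)) (negPf (ev i2 isT)) /= => ->.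
Qed.

(** A walk can always continue, as an even degree provides a second edge at the vertex just entered.
    With four vertices in all, its first five cannot be distinct. *)
Lemma even_cycle Y : Y != set0 -> (forall A : {set 'I_4}, A \in Y -> #|A| = 2) ->
  (forall i, ~~ odd (deg Y i)) ->
  exists2 s : seq 'I_4, (2 < size s)%N & ucycle (adjacent Y) s.
Proof.
move=> /set0Pn[A0 A0Y] Y2 ev.
have next i j : i != j -> [set i; j] \in Y ->
    exists k, [/\ k != i, k != j & [set j; k] \in Y].
  move=> ij ijY.
  have ijD : [set i; j] \in [set A in Y | j \in A] by rewrite !inE ijY eqxx orbT.
  have [D0|[A]] := set_0Vmem ([set A in Y | j \in A] :\ [set i; j]).
    have := ev j; rewrite /deg (cardsD1 [set i; j]) ijD D0 cards0.
    by [].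
  rewrite !inE => /and3P[Aij AY jA].
  have := Y2 A AY; rewrite (cardsD1 j) jA => -[] /eqP/cards1P[k Ak].
  have eqA : A = [set j; k] by rewrite -(setD1K jA) Ak.
  have kA : k \in A :\ j by rewrite Ak inE.
  exists k; rewrite -eqA AY; split=> //; last by case/setD1P: kA.
  by apply: contraNneq Aij => ki; rewrite eqA ki setUC.
have /eqP/cards2P[i [j [ij A0E]]] := Y2 A0 A0Y; rewrite {}A0E in A0Y.
have [k [ki kj jk]] := next i j ij A0Y.
have jk' : j != k by rewrite eq_sym.
have [l [lj lk kl]] := next j k jk' jk.
have adjI x y : x != y -> [set x; y] \in Y -> adjacent Y x y.
  by move=> xy xyY; rewrite /adjacent /= xy.
have ik : i != k by rewrite eq_sym.
have [li|li] := eqVneq l i.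
  exists [:: i; j; k] => //; apply/andP; split.
    by rewrite /= !adjI // -?li // eq_sym.
  by rewrite /= !inE negb_or ij ik jk'.
have kl' : k != l by rewrite eq_sym.
have jl : j != l by rewrite eq_sym.
have il : i != l by rewrite eq_sym.
have [m [mk ml lm]] := next k l kl' kl.
have [mi|mi] := eqVneq m i.
  exists [:: i; j; k; l] => //; apply/andP; split.
    by rewrite /= !adjI // -?mi // eq_sym.
  by rewrite /= !inE !negb_or ij ik il jk' jl kl'.
have [mj|mj] := eqVneq m j.
  exists [:: j; k; l] => //; apply/andP; split.
    by rewrite /= !adjI // -?mj // eq_sym.
  by rewrite /= !inE !negb_or jk' jl kl'.
have /card_uniqP : uniq [:: i; j; k; l; m].
  by rewrite /= !inE !negb_or ij ik il jk' jl kl' ![_ == m]eq_sym mi mj mk ml.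
by move=> h; have := max_card [in [:: i; j; k; l; m]]; rewrite h card_ord.
Qed.

(** On four vertices a cycle has length three or four, and each of its vertices occurs in two of its
    edges. *)
Lemma cycle_sum_eq0 Y s : (2 < size s)%N -> ucycle (adjacent Y) s ->
  exists Q, [/\ Q \subset Y, Q != set0 & \sum_(A in Q) phi A = 0].
Proof.
move=> s2 /andP[cyc un].
have nin i j k l : i != k -> i != l -> [set i; j] != [set k; l].
  move=> ik il; apply/eqP => /setP/(_ i).
  by rewrite !inE eqxx (negPf ik) (negPf il).
have : (size s <= 4)%N.
  by have := max_card [in s]; rewrite (card_uniqP un) card_ord.
case: s s2 cyc un => [|i [|j [|k [|l [|m s]]]]] //= _.
  case/and4P => /andP[ij ijY] /andP[jk jkY] /andP[ki kiY] _ _ _.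
  have [ji kj ik] : [/\ j != i, k != j & i != k].
    by split; rewrite eq_sym.
  exists [set [set i; j]; [set j; k]; [set k; i]]; split.
  - by rewrite !subUset !sub1set ijY jkY.
  - by apply/set0Pn; exists [set i; j]; rewrite !inE eqxx.
  have n1 : [set i; j] != [set j; k] by apply: nin.
  have n2 : [set k; i] != [set i; j] by apply: nin.
  have n3 : [set k; i] != [set j; k].
    by rewrite [X in X != _]setUC [X in _ != X]setUC eq_sym setUC eq_sym nin.
  rewrite setUC big_setU1 ?inE ?negb_or ?n2 //= big_setU1 ?inE //= big_set1.
  by rewrite !edge_vec2 //; move: (p i) (p j) (p k) => x y z; vec_ring.
case/and5P => /andP[ij ijY] /andP[jk jkY] /andP[kl klY] /andP[li liY] _.
rewrite !inE !negb_or => /and4P[/and3P[_ ik il] /andP[_ jl] _ _] _.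
have [ki lj lk ji] : [/\ k != i, l != j, l != k & j != i].
  by split; rewrite eq_sym.
have [kj il'] : k != j /\ i != l by split; rewrite eq_sym.
exists ([set i; j] |: ([set k; l] |: ([set j; k] |: [set [set l; i]]))); split.
- by rewrite !subUset !sub1set ijY jkY klY.
- by apply/set0Pn; exists [set i; j]; rewrite setU11.
have n1 : [set i; j] != [set k; l] by apply: nin.
have n2 : [set k; l] != [set j; k] by rewrite [X in X != _]setUC nin.
have n3 : [set i; j] != [set j; k] by apply: nin.
have n4 : [set i; j] != [set l; i] by rewrite [X in X != _]setUC nin.
have n5 : [set k; l] != [set l; i] by apply: nin.
have n6 : [set j; k] != [set l; i] by apply: nin.
rewrite big_setU1 ?inE ?negb_or ?n1 ?n3 ?n4 //=.
rewrite big_setU1 ?inE ?negb_or ?n2 ?n5 //= big_setU1 ?inE //= big_set1.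
rewrite !edge_vec2 //; move: (p i) (p j) (p k) (p l) => x y z t; vec_ring.
Qed.

Section Isomorphism.

Variables (T : finType) (N : matroid T) (w : T -> 'rV['F_2]_n).
Hypotheses (rN : represents w N) (w_inj : {in ground N &, injective w}).
Hypothesis N_edge : forall x, x \in ground N ->
  exists2 A : {set 'I_4}, #|A| = 2 & phi A = w x.
Hypothesis edge_N : forall A : {set 'I_4}, #|A| = 2 ->
  exists2 x, x \in ground N & w x = phi A.

(** Dependence means a nonempty subset with sum 0. A cycle provides one by [cycle_sum_eq0];
    conversely, such a subset has even degrees and hence contains a cycle. *)
Lemma iso_MK4 : iso_cycle_matroid (complete_graph 'I_4) N.
Proof.
pose f x := odflt set0 [pick A : {set 'I_4} | (#|A| == 2) && (phi A == w x)].
have fP x : x \in ground N -> #|f x| = 2 /\ phi (f x) = w x.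
  move=> xN; rewrite /f; case: pickP => [A /andP[/eqP ? /eqP ?] //|h].
  by have [A A2 Ax] := N_edge xN; have := h A; rewrite A2 Ax !eqxx.
have f_inj : {in ground N &, injective f}.
  move=> x y xN yN fxy; apply: w_inj => //.
  by have [[_ <-] [_ <-]] := (fP x xN, fP y yN); rewrite fxy.
have sum_f (Q : {set T}) : Q \subset ground N ->
    \sum_(A in f @: Q) phi A = \sum_(x in Q) w x.
  move=> QN; rewrite big_imset /=.
    by apply: eq_bigr => x /(subsetP QN) /fP[].
  by move=> x y /(subsetP QN) xN /(subsetP QN) yN; apply: f_inj.
exists f; split=> //.
  apply/setP => A; rewrite inE; apply/imsetP/eqP => [[x xN ->]|A2].
    by case: (fP x xN).
  have [x xN wx] := edge_N A2; exists x => //.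
  by have [fx2 fx] := fP x xN; apply: edge_vec_inj; rewrite ?A2 ?fx2 ?fx.
move=> X XN; rewrite (rN XN); split.
  move=> /free_sum_neq0 fr s s2 /(cycle_sum_eq0 s2)[Q [QX Q0 sQ]].
  pose Q' := [set x in X | f x \in Q].
  have Q'X : Q' \subset X by apply/subsetP => x; rewrite inE => /andP[].
  have fQ' : f @: Q' = Q.
    apply/setP => A; apply/imsetP/idP => [[x + ->]|AQ].
      by rewrite inE => /andP[].
    have /imsetP[x xX Ax] := subsetP QX A AQ.
    by exists x; rewrite // inE xX -Ax.
  have Q'0 : Q' != set0.
    by apply: contraNneq Q0 => Q'0; rewrite -fQ' Q'0 imset0.
  case/eqP: (fr Q' Q'X Q'0).
  by rewrite -sum_f ?fQ' // (subset_trans Q'X).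
move=> fst; apply/free_sum_neq0 => Q QX Q0; apply/eqP => sQ.
have QN := subset_trans QX XN.
have Y2 A : A \in f @: Q -> #|A| = 2.
  by case/imsetP => x /(subsetP QN)/fP[? _] ->.
have [||s s2 /andP[cyc un]] := @even_cycle (f @: Q) _ Y2 _.
- by rewrite imset_eq0.
- by apply: even_degrees => //; rewrite sum_f.
case: (fst s s2); rewrite /ucycle un andbT; apply: sub_cycle cyc => x y.
by rewrite /adjacent /= => /andP[-> /(subsetP (imsetS f QX))].
Qed.

End Isomorphism.

End CompleteGraph.

(** * Translating the hypotheses on the matroid, and the theorem *)

Section Transfer.

Variables (T : finType) (n : nat).
Notation V := 'rV['F_2]_n.
Implicit Types (M N : matroid T) (v : T -> V).

(** If the class of [a + b + c] is missed, contract the elements with vectors in [X], simplify, and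
    restrict to the flat spanned by the images of [a], [b], [c]. The six other classes remain, and
    they form M(K_4). *)
Lemma represents_K4_closed v N : represents v N -> ~ has_induced_minor_MK4 N ->
  K4_closed (v @: ground N).
Proof.
move=> rN nK X a b c XE aE bE cE ind hab hac hbc.
apply: contraT => nabc; case: nK.
pose G := [set x in ground N | v x \in X].
have GN : G \subset ground N by apply/subsetP => x; rewrite inE => /andP[].
have vG : v @: G = X.
  apply/setP => u; apply/imsetP/idP => [[x + ->]|uX]; first by rewrite inE => /andP[].
  have /imsetP[x xN ux] := subsetP XE u uX.
  by exists x; rewrite // inE xN -ux.
have [f kerf] := lker_exists (sp X).
have kerP u : (f u == 0) = (u \in sp X) by rewrite -memv_ker kerf.
pose N1 := contract N G; pose w : T -> V := f \o v.
have r1 : represents w N1 by apply: represents_contract; rewrite ?vG.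
have simp := class_reps_simplification r1; set S := class_reps w N1 in simp.
pose N2 := restrict N1 S.
have r2 : represents w N2 by apply: represents_restrict.
pose W := sp [set f a; f b; f c]; pose F := [set x in ground N2 | w x \in W].
have flF : flat N2 F by apply: flat_preimage.
pose N3 := restrict N2 F.
have r3 : represents w N3 by apply: represents_restrict.
exists N3; split.
  apply: induced_minor_flat flF.
  exact: induced_minor_contract (induced_minor_refl N) GN simp.
have SN1 : S \subset ground N1 by apply/subsetP => x; rewrite inE => /andP[].
have gN3 x : (x \in ground N3) = (x \in S) && (w x \in W).
  have -> : (x \in ground N3) = (x \in ground N2) && (x \in F) by rewrite in_setI.
  have e2 : (x \in ground N2) = (x \in ground N1) && (x \in S) by rewrite in_setI.
  rewrite [x \in F]inE e2.
  by case: (boolP (x \in S)) => [/(subsetP SN1)->|]; rewrite ?andbF.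
have indf : indep3 0%VS (f a) (f b) (f c).
  by rewrite /indep3 -!linearD /= !memv0 !kerP.
have [a_ b_ c_ ab_ /and3P[ac_ bc_ abc_]] := and5P ind.
have hits u : u \notin sp X -> hit (v @: ground N) (sp X) u ->
    exists2 y, y \in S & w y = f u.
  move=> uX /hitP[_ /imsetP[y yN ->] yu].
  have wy : w y = f u.
    by apply/eqP; rewrite -F2_addv_eq0 -linearD kerP.
  have [||z zS wz] := @class_reps_image _ _ w N1 y; last by exists z; rewrite ?wz.
    rewrite !inE yN andbT /=.
    by apply: contra uX => /mem_sp; rewrite (memv_hit yu).
  by rewrite wy kerP.
pose p i := nth 0 [:: a; b; c] i.
have pf (i : 'I_4) : vertex_vec (f a) (f b) (f c) i = f (p i).
  by case: i => [[|[|[|[|]]]]] //= Hi; rewrite linear0.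
have pW (i : 'I_4) : f (p i) \in W.
  case: i => [[|[|[|[|]]]]] //= Hi; rewrite ?linear0 ?mem0v //;
  by rewrite mem_sp // !inE eqxx ?orbT.
(* Since [p] is 0 at the vertex 3, the edges give [a], [b], [c] and their three pairwise sums. *)
have pairs (i j : 'I_4) : i != j ->
    (p i + p j \notin sp X) && hit (v @: ground N) (sp X) (p i + p j).
  have [ha hb hc] : [/\ hit (v @: ground N) (sp X) a,
    hit (v @: ground N) (sp X) b & hit (v @: ground N) (sp X) c].
    by split; apply: mem_hit.
  case: i => [[|[|[|[|]]]]] // Hi; case: j => [[|[|[|[|]]]]] // Hj;
    rewrite /p /= ?addr0 ?add0r ?a_ ?b_ ?c_ ?ab_ ?ac_ ?bc_ //=;
    rewrite ?[c + _]addrC ?[b + a]addrC ?ab_ ?ac_ ?bc_ //;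
    by move=> /eqP[]; apply: val_inj.
apply: (iso_MK4 indf r3).
- move=> x y; rewrite !gN3 => /andP[xS _] /andP[yS _].
  exact: (class_reps_inj xS yS).
- move=> x; rewrite gN3 => /andP[xS xW].
  have xN : x \in ground N by have := subsetP SN1 x xS; rewrite inE => /andP[].
  have x0 : w x != 0 by move: xS; rewrite inE => /and3P[].
  have nx : w x != f (a + b + c).
    apply: contra nabc; rewrite -F2_addv_eq0 -linearD kerP => h.
    by apply/hitP; exists (v x) => //; apply: imset_f.
  suff [i [j [ij wx]]] : exists i j : 'I_4, i != j /\ w x = f (p i) + f (p j).
    exists [set i; j]; first by rewrite cards2 ij.
    by rewrite edge_vec2 // !pf.
  pose i0 : 'I_4 := @Ordinal 4 0 isT; pose i1 : 'I_4 := @Ordinal 4 1 isT.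
  pose i2 : 'I_4 := @Ordinal 4 2 isT; pose i3 : 'I_4 := @Ordinal 4 3 isT.
  have e3 : f (p i3) = 0 by rewrite linear0.
  move: xW; rewrite /W => /spUP[u [t [/mem_sp2 uE]]].
  rewrite sp1 => /memv_line2 tE wx; rewrite !linearD /= in nx.
  case: uE => uE; case: tE => tE; rewrite uE tE ?addr0 ?add0r in wx.
  - by rewrite wx eqxx in x0.
  - by exists i2, i3; rewrite e3 addr0.
  - by exists i0, i3; rewrite e3 addr0.
  - by exists i0, i2.
  - by exists i1, i3; rewrite e3 addr0.
  - by exists i1, i2.
  - by exists i1, i0.
  by move: nx; rewrite wx [f b + _]addrC eqxx.
move=> A /eqP/cards2P[i [j [ij ->]]].
have /andP[ijX ijh] := pairs i j ij.
have [y yS wy] := hits _ ijX ijh; exists y.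
  by rewrite gN3 yS wy linearD rpredD ?pW.
by rewrite edge_vec2 // !pf wy linearD.
Qed.

Lemma simple_represents v M : represents v M -> simple_matroid M ->
  {in ground M, forall x, v x != 0} /\ {in ground M &, injective v}.
Proof.
move=> rM simM; have nz : {in ground M, forall x, v x != 0}.
  move=> x xM; apply/negP => x0.
  have /simM : circuit M [set x] by rewrite (circuit_set1 _ rM) xM.
  by rewrite cards1.
split=> // x y xM yM vxy.
have xnl : x \in nonloops M by rewrite inE xM /loop (circuit_set1 _ rM) xM (negPf (nz x xM)).
have := parallelE rM xnl yM; rewrite vxy eqxx /parallel.
by case/orP => [/eqP //|/simM]; rewrite cards2; case: (_ == _).
Qed.

(** Partitions pull back along the injective [v], and the excess of the two ranks over the rank of
    [M] is the dimension of the intersection of the spans. Order 2 gives the first clause of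
    [conn3], and order 1 at a singleton excludes coloops. *)
Lemma represents_conn3 v M : represents v M -> simple_matroid M ->
  n_connected 3 M -> conn3 (v @: ground M).
Proof.
move=> rM simM conM; have [nz inj] := simple_represents rM simM.
set E : {set V} := v @: ground M.
have sepE k (S : {set V}) : S \subset E -> (0 < k < 3)%N -> (k <= #|S|)%N ->
    (k <= #|E :\: S|)%N -> (\dim (sp S :&: sp (E :\: S)) < k)%N -> False.
  move=> SE k3 kS kS' dimS; pose X := [set x in ground M | v x \in S].
  have XM : X \subset ground M by apply/subsetP => x; rewrite inE => /andP[].
  have X'M : ground M :\: X \subset ground M by apply: subsetDl.
  have vX : v @: X = S.
    apply/setP => u; apply/imsetP/idP => [[x + ->]|uS]; first by rewrite inE => /andP[].
    have /imsetP[x xM ux] := subsetP SE u uS.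
    by exists x; rewrite // inE xM -ux.
  have vX' : v @: (ground M :\: X) = E :\: S.
    apply/setP => u; rewrite in_setD; apply/imsetP/andP => [[x + ->]|[uS /imsetP[x xM ux]]].
      by rewrite in_setD inE => /andP[+ xM]; rewrite xM /= => xS; rewrite imset_f.
    by exists x; rewrite // in_setD inE xM -ux uS.
  have card_im (Y : {set T}) : Y \subset ground M -> #|v @: Y| = #|Y|.
    move=> YM; apply: card_in_imset => x y xY yY.
    by apply: inj; apply: (subsetP YM).
  case/negP: (conM k X k3); apply/and4P; split=> //.
  - by rewrite -card_im // vX.
  - by rewrite -card_im // vX'.
  rewrite !(rank_dim rM) // vX vX' -dimv_sum_cap -spU.
  have -> : S :|: E :\: S = E.
    apply/setP => u; rewrite in_setU in_setD.
    by case: (boolP (u \in S)) => [/(subsetP SE)->|].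
  by rewrite -addnS leq_add2l.
split=> [S t SE sep|x xE Ex].
  case: leqP => S1; first by left.
  case: leqP => S'1; first by right.
  case: (sepE 2 S) => //; rewrite ltnS.
  apply: leq_trans (dimvS (_ : _ <= <[t]>)%VS) _; last by rewrite dim_vline leq_b1.
  apply/subvP => u; rewrite memv_cap => /andP[uS uS'].
  by case: (sep u uS uS') => ->; rewrite ?mem0v ?memv_line.
apply: contraT => xnE; case: (sepE 1%N [set x]) => //.
- by rewrite sub1set.
- by rewrite cards1.
- rewrite card_gt0; apply: contraNneq Ex => h.
  by rewrite eqEsubset sub1set xE andbT -setD_eq0 h.
rewrite ltnS leqn0 dimv_eq0 -subv0; apply/subvP => u; rewrite memv_cap sp1 memv0.
case/andP => /memv_line2[->//|->]; by rewrite (negPf xnE).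
Qed.

End Transfer.

Theorem theorem1p7 (T : finType) (M : matroid T) (e : T) :
  n_connected 3 M -> simple_matroid M -> binary M -> e \in ground M ->
  ~ has_induced_minor_MK4 M ->
  ~ has_induced_minor_MK4 (delete M e) ->
  forall x : T, x \in ground M :\ e ->
    exists C : {set T}, [/\ triangle M C, e \in C & x \in C].
Proof.
move=> conM simM [n [v rM]] eM nK nKe x /setD1P[xe xM].
have {}rM : represents v M := rM.
have [nz inj] := simple_represents rM simM.
have thE : thin (v @: ground M) (v e).
  split; [|exact: imset_f|exact: represents_K4_closed|].
    by apply/imsetP => -[y yM /esym/eqP]; rewrite (negPf (nz y yM)).
  (* As [v] is injective on the ground set, deleting [e] removes exactly the vector [v e]. *)
  have -> : v @: ground M :\ v e = v @: ground (delete M e).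
    apply/setP => u; apply/setD1P/imsetP => [[ue /imsetP[y yM uy]]|[y]].
      exists y => //; rewrite !inE yM andbT /=.
      by apply: contraNneq ue => <-; rewrite uy.
    rewrite !inE => /and3P[yM ye _] ->; split; last exact: imset_f.
    by apply: contraNneq ye => /inj->.
  by apply: represents_K4_closed nKe; apply: represents_restrict.
have vxe : v x != v e by apply: contraNneq xe => /inj->.
have conE := represents_conn3 rM simM conM.
have /imsetP[y yM vy] := thin_tip thE conE (imset_f v xM) vxe.
have yx : y != x.
  apply: contraNneq (nz e eM) => yx; apply/eqP.
  by rewrite -[v e](F2_addvK _ (v x)) [v e + _]addrC vy yx F2_addvv.
have ye : y != e.
  apply: contraNneq (nz x xM) => ye; apply/eqP.
  by rewrite -[v x](F2_addvK _ (v e)) vy ye F2_addvv.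
have cC : #|[set e; x; y]| = 3.
  by rewrite setUC cardsU1 cards2 !inE negb_or ye yx eq_sym xe.
exists [set e; x; y]; split; rewrite ?inE ?eqxx ?orbT //.
rewrite /triangle cC eqxx andbT.
have CM : [set e; x; y] \subset ground M by rewrite !subUset !sub1set eM xM.
apply/minsetP; split=> [|B /= /andP[BM dB] BC].
  rewrite /= CM rM //; apply/negP => /free_sum_neq0/(_ _ (subxx _)).
  have -> : [set e; x; y] != set0 by rewrite -card_gt0 cC.
  rewrite setUC big_setU1 ?inE ?negb_or ?ye //= big_setU1 ?inE 1?eq_sym //=.
  by rewrite big_set1 -vy [v x + v e]addrC F2_addvv eqxx => /(_ isT).
(* A dependent subset contains a circuit, which has at least three elements by simplicity; hence the
   triple is minimal. *)
have [C' cC' C'B] := minset_exists (P := [pred A : {set T} |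
  (A \subset ground M) && (A \notin indep M)]) (introT andP (conj BM dB)).
apply/eqP; rewrite eqEcard BC cC; apply: leq_trans (subset_leq_card C'B).
exact: simM.
Qed.
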